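(* In the setting described in the context, suppose $(r,\eta)\in\mathcal K$ and that there exist constants $\hat c_1,\hat c_2>0$ with $\|A_dh\|\ge\hat c_d\|h\|$ for all $h\in\mathbb C^{n_d}$, $d=1,2$. Then every limit point of the sequence $\{X^n\}$ is a stationary point of the saddle point problem $\max_{\Lambda_{1,2},\Lambda_{2,1},\Gamma_1,\Gamma_2}\min_{u_1,u_2,v,z_1,z_2}\mathcal L$, i.e. a point at which the gradient of $\mathcal L$ with respect to all of its variables vanishes.
   Context: Notation: $\|\cdot\|$ is the Euclidean norm on vectors and the induced operator (spectral) norm on linear maps; $\Re$ denotes real part and $\langle a,b\rangle=\sum_j a(j)\overline{b(j)}$. Real-valued functions of complex vectors are differentiated by identifying $\mathbb C^k$ with $\mathbb R^{2k}$; gradients are real gradients written as complex vectors. Metric: fix $\epsilon\in(0,1)$ and put $L:=\frac2\epsilon-1$. For $x\in\mathbb C$, $b\ge0$, let $g_\epsilon(x;b)=\frac{1-\epsilon}{2}(b-\frac1\epsilon|x|^2)$ if $|x|<\epsilon\sqrt b$ and $g_\epsilon(x;b)=\frac12(|x|-\sqrt b)^2$ otherwise; for $z\in\mathbb C^k$, $f\in\mathbb R^k_+$, $\mathcal G_\epsilon(z;f)=\sum_j g_\epsilon(z(j);f(j))$. Domain decomposition: $\Omega=\{0,\dots,n-1\}$ (pixels of an image $u\in\mathbb C^n$) is covered by two index sets $\Omega_1,\Omega_2$ with $\Omega_1\cup\Omega_2=\Omega$, $|\Omega_d|=n_d$, $\Omega_d=\{l^d_0<\dots<l^d_{n_d-1}\}$,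 and nonempty overlap $\Omega_{1,2}=\Omega_1\cap\Omega_2=\{\hat l_0<\dots<\hat l_{\hat n-1}\}$. Restrictions: $R_d:\mathbb C^n\to\mathbb C^{n_d}$, $(R_du)(j)=u(l^d_j)$; $R_{1,2}:\mathbb C^n\to\mathbb C^{\hat n}$, $(R_{1,2}u)(j)=u(\hat l_j)$. Set $\pi_{1,2}:=R_{1,2}R_1^T:\mathbb C^{n_1}\to\mathbb C^{\hat n}$ and $\pi_{2,1}:=R_{1,2}R_2^T:\mathbb C^{n_2}\to\mathbb C^{\hat n}$. Forward operators: a probe $w\in\mathbb C^{\bar m}$ is given, $\mathcal F$ is the normalized (unitary) discrete Fourier transform on $\mathbb C^{\bar m}$, $\circ$ is entrywise product. For $d=1,2$ there are binary matrices $\mathcal S^d_j\in\{0,1\}^{\bar m\times n_d}$, $j=0,\dots,J_d-1$, each row of which contains exactly one entry equal to $1$. Define $A_d:\mathbb C^{n_d}\to\mathbb C^{m_d}$, $m_d=J_d\bar m$, by $A_du_d=\big(\mathcal F(w\circ\mathcal S^d_0u_d);\dots;\mathcal F(w\circ\mathcal S^d_{J_d-1}u_d)\big)$ (stacked). Data $f_d\in\mathbb R_+^{m_d}$, $d=1,2$, are given. Augmented Lagrangian, with parameters $r,\eta>0$, for $u_d\in\mathbb C^{n_d}$, $v,\Lambda_{1,2},\Lambda_{2,1}\in\mathbb C^{\hat n}$, $z_d,\Gamma_d\in\mathbb C^{m_d}$: $$\mathcal L(u_1,u_2,v,z_1,z_2,\Lambda_{1,2},\Lambda_{2,1},\Gamma_1,\Gamma_2)=\sum_{d=1}^2\mathcal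 G_\epsilon(z_d;f_d)+r\sum_{d=1}^2\Big(\Re\langle\Lambda_{d,3-d},\pi_{d,3-d}u_d-v\rangle+\tfrac12\|\pi_{d,3-d}u_d-v\|^2\Big)+\eta\sum_{d=1}^2\Big(\Re\langle\Gamma_d,A_du_d-z_d\rangle+\tfrac12\|A_du_d-z_d\|^2\Big).$$ Algorithm (OD$^2$P): start with $u_d^0=\mathbf 1$ (all ones), any $v^0\in\mathbb C^{\hat n}$, $z_d^0=A_du_d^0$, $\Gamma_d^0=0$, $\Lambda_{1,2}^0=\Lambda_{2,1}^0=0$. For $n\ge0$ and $d=1,2$: (i) $z_d^{n+1}$ is a minimizer of $z\mapsto\mathcal G_\epsilon(z;f_d)+\frac\eta2\|z-(\Gamma_d^n+A_du_d^n)\|^2$, and $v^{n+1}=\frac12\sum_{d=1}^2(\pi_{d,3-d}u_d^n+\Lambda^n_{d,3-d})$; (ii) $\Gamma_d^{n+1}=\Gamma_d^n+A_du_d^n-z_d^{n+1}$; (iii) $u_d^{n+1}$ is a minimizer of $u\mapsto\frac\eta2\|A_du+\Gamma_d^{n+1}-z_d^{n+1}\|^2+\frac r2\|\pi_{d,3-d}u-v^{n+1}+\Lambda^n_{d,3-d}\|^2$; (iv) $\Lambda^{n+1}_{d,3-d}=\Lambda^n_{d,3-d}+\pi_{d,3-d}u_d^{n+1}-v^{n+1}$. Write $X^n=(u_1^n,u_2^n,v^n,z_1^n,z_2^n,\Lambda_{1,2}^n,\Lambda_{2,1}^n,\Gamma_1^n,\Gamma_2^n)$. Parameter set: $\mathcal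 K$ is the set of $(r,\eta)\in\mathbb R_+^2$ such that $\eta\ge1$, $r-\eta\max\{2\|A_1^*A_1\|,2\|A_2^*A_2\|,\|\pi_{1,2}A_1^*\|,\|\pi_{2,1}A_2^*\|\}>0$, and $\frac{\eta-3L}{2}-\frac{L^2}{\eta}-\frac{2(L+\eta)^2}{r^2}\max\{\|\pi_{1,2}A_1^*\|^2,\|\pi_{2,1}A_2^*\|^2\}>0$. *)

(* Defs.v *)
From HB Require Import structures.
From mathcomp Require Import all_boot all_order all_algebra.
From mathcomp Require Import complex.
From mathcomp Require Import all_classical all_reals all_analysis.

Set Implicit Arguments.
Unset Strict Implicit.
Unset Printing Implicit Defensive.

Import Order.TTheory GRing.Theory Num.Theory.
Local Open Scope ring_scope.
Local Open Scope complex_scope.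
Local Open Scope classical_set_scope.

Section Defs.
Variable R : realType.
Local Notation C := R[i].

Definition cabs (z : C) : R := Num.sqrt (complex.Re z ^+ 2 + complex.Im z ^+ 2).
Definition cconj (z : C) : C := complex.Re z -i* complex.Im z.

Definition vnorm k (v : 'cV[C]_k) : R :=
  Num.sqrt (\sum_(j < k) cabs (v j 0) ^+ 2).

Definition rinner k (a b : 'cV[C]_k) : R :=
  complex.Re (\sum_(j < k) a j 0 * cconj (b j 0)).

Definition adj m k (M : 'M[C]_(m, k)) : 'M[C]_(k, m) :=
  \matrix_(i, j) cconj (M j i).

Definition opnorm m k (M : 'M[C]_(m, k)) : R :=
  sup [set vnorm (M *m h) | h in [set h : 'cV[C]_k | vnorm h <= 1]].

Definition geps (eps : R) (x : C) (b : R) : R :=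
  if cabs x < eps * Num.sqrt b
  then (1 - eps) / 2 * (b - eps^-1 * cabs x ^+ 2)
  else 2^-1 * (cabs x - Num.sqrt b) ^+ 2.

Definition Geps (eps : R) m (z : 'cV[C]_m) (f : 'cV[R]_m) : R :=
  \sum_(j < m) geps eps (z j 0) (f j 0).

(* restriction operator R_S : C^n -> C^{|S|}, (R_S u)(j) = u(l_j) where
   l_0 < ... < l_{|S|-1} enumerate S increasingly (enum_val) *)
Definition restr n (S : {set 'I_n}) : 'M[C]_(#|S|, n) :=
  \matrix_(j, i) (if i == enum_val j then 1 else 0).

Definition cis (t : R) : C := cos t +i* sin t.
Definition dft mb : 'M[C]_mb :=
  \matrix_(k, l) (((Num.sqrt (mb%:R))^-1)%:C
                   * cis (- (2 * pi * (k%:R) * (l%:R) / mb%:R))).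

Definition Ablock mb nd (w : 'cV[C]_mb) (S : 'M[C]_(mb, nd)) : 'M[C]_(mb, nd) :=
  dft mb *m diag_mx (w^T) *m S.

(* stacked forward operator A : C^nd -> C^(J*mb); row (j, r) is at
   index j*mb + r (mxvec is row-major) *)
Definition Aop mb nd J (w : 'cV[C]_mb) (S : 'I_J -> 'M[C]_(mb, nd))
  : 'M[C]_(J * mb, nd) :=
  \matrix_(k, i) (mxvec (\matrix_(j, r) (Ablock w (S j) r i)) 0 k).

Definition selection_mx mb nd (S : 'M[C]_(mb, nd)) : Prop :=
  (forall r c, S r c = 0 \/ S r c = 1) /\
  (forall r, #|[set c | S r c == 1]| = 1%N).

Definition Lag (eps r eta : R) n1 n2 nh m1 m2
  (A1 : 'M[C]_(m1, n1)) (A2 : 'M[C]_(m2, n2))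
  (P12 : 'M[C]_(nh, n1)) (P21 : 'M[C]_(nh, n2))
  (f1 : 'cV[R]_m1) (f2 : 'cV[R]_m2)
  (u1 : 'cV[C]_n1) (u2 : 'cV[C]_n2) (v : 'cV[C]_nh)
  (z1 : 'cV[C]_m1) (z2 : 'cV[C]_m2) (L12 L21 : 'cV[C]_nh)
  (G1 : 'cV[C]_m1) (G2 : 'cV[C]_m2) : R :=
  Geps eps z1 f1 + Geps eps z2 f2
  + r * ((rinner L12 (P12 *m u1 - v) + 2^-1 * vnorm (P12 *m u1 - v) ^+ 2)
       + (rinner L21 (P21 *m u2 - v) + 2^-1 * vnorm (P21 *m u2 - v) ^+ 2))
  + eta * ((rinner G1 (A1 *m u1 - z1) + 2^-1 * vnorm (A1 *m u1 - z1) ^+ 2)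
         + (rinner G2 (A2 *m u2 - z2) + 2^-1 * vnorm (A2 *m u2 - z2) ^+ 2)).

(* all real partial derivatives of F : C^k -> R at x vanish, i.e. the
   partial derivatives w.r.t. Re x(j) (direction e_j) and Im x(j)
   (direction i e_j) exist and are 0 *)
Definition partials_zero k (F : 'cV[C]_k -> R) (x : 'cV[C]_k) : Prop :=
  forall (j : 'I_k) (c : C), (c = 1 \/ c = 'i) ->
    is_derive (0 : R) (1 : R)
      (fun t : R => F (x + (t%:C * c) *: delta_mx j 0)) 0.

Record state (n1 n2 nh m1 m2 : nat) := State {
  su1 : 'cV[C]_n1; su2 : 'cV[C]_n2; sv : 'cV[C]_nh;
  sz1 : 'cV[C]_m1; sz2 : 'cV[C]_m2;
  sL12 : 'cV[C]_nh; sL21 : 'cV[C]_nh;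
  sG1 : 'cV[C]_m1; sG2 : 'cV[C]_m2 }.

Definition sdist n1 n2 nh m1 m2 (X Y : state n1 n2 nh m1 m2) : R :=
  Num.sqrt (vnorm (su1 X - su1 Y) ^+ 2 + vnorm (su2 X - su2 Y) ^+ 2
          + vnorm (sv X - sv Y) ^+ 2 + vnorm (sz1 X - sz1 Y) ^+ 2
          + vnorm (sz2 X - sz2 Y) ^+ 2 + vnorm (sL12 X - sL12 Y) ^+ 2
          + vnorm (sL21 X - sL21 Y) ^+ 2 + vnorm (sG1 X - sG1 Y) ^+ 2
          + vnorm (sG2 X - sG2 Y) ^+ 2).

Definition seq_limit_point n1 n2 nh m1 m2 (X : nat -> state n1 n2 nh m1 m2)
  (Xs : state n1 n2 nh m1 m2) : Prop :=
  exists phi : nat -> nat, and (forall k, (phi k < phi k.+1)%N)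
    ((fun k => sdist (X (phi k)) Xs) @ \oo --> 0%R).

Definition LagS (eps r eta : R) n1 n2 nh m1 m2
  (A1 : 'M[C]_(m1, n1)) (A2 : 'M[C]_(m2, n2))
  (P12 : 'M[C]_(nh, n1)) (P21 : 'M[C]_(nh, n2))
  (f1 : 'cV[R]_m1) (f2 : 'cV[R]_m2) (X : state n1 n2 nh m1 m2) : R :=
  Lag eps r eta A1 A2 P12 P21 f1 f2 (su1 X) (su2 X) (sv X) (sz1 X) (sz2 X)
      (sL12 X) (sL21 X) (sG1 X) (sG2 X).

Definition stationary (eps r eta : R) n1 n2 nh m1 m2
  (A1 : 'M[C]_(m1, n1)) (A2 : 'M[C]_(m2, n2))
  (P12 : 'M[C]_(nh, n1)) (P21 : 'M[C]_(nh, n2))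
  (f1 : 'cV[R]_m1) (f2 : 'cV[R]_m2) (X : state n1 n2 nh m1 m2) : Prop :=
  let L := Lag eps r eta A1 A2 P12 P21 f1 f2 in
  let: State u1 u2 v z1 z2 L12 L21 G1 G2 := X in
  and
  [/\ partials_zero (fun x => L x u2 v z1 z2 L12 L21 G1 G2) u1,
      partials_zero (fun x => L u1 x v z1 z2 L12 L21 G1 G2) u2,
      partials_zero (fun x => L u1 u2 x z1 z2 L12 L21 G1 G2) v,
      partials_zero (fun x => L u1 u2 v x z2 L12 L21 G1 G2) z1 &
      partials_zero (fun x => L u1 u2 v z1 x L12 L21 G1 G2) z2]
  [/\       partials_zero (fun x => L u1 u2 v z1 z2 x L21 G1 G2) L12,
      partials_zero (fun x => L u1 u2 v z1 z2 L12 x G1 G2) L21,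
      partials_zero (fun x => L u1 u2 v z1 z2 L12 L21 x G2) G1 &
      partials_zero (fun x => L u1 u2 v z1 z2 L12 L21 G1 x) G2].

(* the sequence X is generated by the OD^2P algorithm (with any choice of
   the minimizers in steps (i) and (iii)) *)
Definition OD2P (eps r eta : R) n1 n2 nh m1 m2
  (A1 : 'M[C]_(m1, n1)) (A2 : 'M[C]_(m2, n2))
  (P12 : 'M[C]_(nh, n1)) (P21 : 'M[C]_(nh, n2))
  (f1 : 'cV[R]_m1) (f2 : 'cV[R]_m2) (X : nat -> state n1 n2 nh m1 m2) : Prop :=
  (* initialization; v^0 arbitrary *)
  and
  [/\ su1 (X 0%N) = const_mx 1, su2 (X 0%N) = const_mx 1,
      sz1 (X 0%N) = A1 *m su1 (X 0%N) & sz2 (X 0%N) = A2 *m su2 (X 0%N)]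
  (and [/\ sG1 (X 0%N) = 0, sG2 (X 0%N) = 0, sL12 (X 0%N) = 0 & sL21 (X 0%N) = 0]
  (forall k : nat, let Xk := X k in let Xk1 := X k.+1 in
  and [/\
      (forall z, Geps eps (sz1 Xk1) f1
                   + eta / 2 * vnorm (sz1 Xk1 - (sG1 Xk + A1 *m su1 Xk)) ^+ 2
                 <= Geps eps z f1
                   + eta / 2 * vnorm (z - (sG1 Xk + A1 *m su1 Xk)) ^+ 2),
      (forall z, Geps eps (sz2 Xk1) f2
                   + eta / 2 * vnorm (sz2 Xk1 - (sG2 Xk + A2 *m su2 Xk)) ^+ 2
                 <= Geps eps z f2
                   + eta / 2 * vnorm (z - (sG2 Xk + A2 *m su2 Xk)) ^+ 2),
      sv Xk1 = 2^-1 *: ((P12 *m su1 Xk + sL12 Xk) + (P21 *m su2 Xk + sL21 Xk)),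
      sG1 Xk1 = sG1 Xk + A1 *m su1 Xk - sz1 Xk1 &
      sG2 Xk1 = sG2 Xk + A2 *m su2 Xk - sz2 Xk1]
      [/\ 
      (forall u, eta / 2 * vnorm (A1 *m su1 Xk1 + sG1 Xk1 - sz1 Xk1) ^+ 2
                 + r / 2 * vnorm (P12 *m su1 Xk1 - sv Xk1 + sL12 Xk) ^+ 2
               <= eta / 2 * vnorm (A1 *m u + sG1 Xk1 - sz1 Xk1) ^+ 2
                 + r / 2 * vnorm (P12 *m u - sv Xk1 + sL12 Xk) ^+ 2),
      (forall u, eta / 2 * vnorm (A2 *m su2 Xk1 + sG2 Xk1 - sz2 Xk1) ^+ 2
                 + r / 2 * vnorm (P21 *m su2 Xk1 - sv Xk1 + sL21 Xk) ^+ 2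
               <= eta / 2 * vnorm (A2 *m u + sG2 Xk1 - sz2 Xk1) ^+ 2
                 + r / 2 * vnorm (P21 *m u - sv Xk1 + sL21 Xk) ^+ 2) &
      [/\ sL12 Xk1 = sL12 Xk + P12 *m su1 Xk1 - sv Xk1
        & sL21 Xk1 = sL21 Xk + P21 *m su2 Xk1 - sv Xk1]])).

Definition paramK (eps r eta : R) n1 n2 nh m1 m2
  (A1 : 'M[C]_(m1, n1)) (A2 : 'M[C]_(m2, n2))
  (P12 : 'M[C]_(nh, n1)) (P21 : 'M[C]_(nh, n2)) : Prop :=
  let L := 2 / eps - 1 in
  [/\ 0 < r, 0 < eta, 1 <= eta,
      r - eta * Num.max (Num.max (2 * opnorm (adj A1 *m A1))
                                 (2 * opnorm (adj A2 *m A2)))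
                        (Num.max (opnorm (P12 *m adj A1))
                                 (opnorm (P21 *m adj A2))) > 0 &
      (eta - 3 * L) / 2 - L ^+ 2 / eta
        - 2 * (L + eta) ^+ 2 / r ^+ 2
          * Num.max (opnorm (P12 *m adj A1) ^+ 2)
                    (opnorm (P21 *m adj A2) ^+ 2) > 0].

End Defs.

(* Main.v *)
Require Import Defs.
From HB Require Import structures.
From mathcomp Require Import all_boot all_order all_algebra.
From mathcomp Require Import complex ring lra.
From mathcomp Require Import all_classical all_reals all_analysis.

Import Order.TTheory GRing.Theory Num.Theory.
Local Open Scope ring_scope.
Local Open Scope complex_scope.

(* Write [c = 1/eps] and, at each step, x, g, y, l, dv for the increments of z_d,
   Gamma_d, u_d, Lambda_{d,3-d} and v. One step changes the Lagrangian by at most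
   the sum over d of
     - (eta+1-c)/2 |x|^2 + eta |g|^2 - eta/2 |Ay|^2 - r/2 |Py|^2
     + r |l|^2 - r/2 |dv|^2,
   with dv = Py - l + l^-, where l^- and x^- are the increments one step earlier.
   Bounding r |l|^2 alone is too expensive on the set K. But
   |Py|^2 + |Py - l + l^-|^2 >= |l - l^-|^2 / 2, so only r/4 |l + l^-|^2 and a
   telescoping term remain, and the optimality of u with PP^* = 1 and
   2 eta ||A^*A|| <= r gives r |l + l^-|^2 <= eta/2 |Ay - x^- + 2g|^2. Since
   eta Gamma = grad G(z) is c-Lipschitz in z, the Lagrangian corrected by
   -r/2 |l|^2 + (eta+2c)/6 |x|^2 decreases by a positive multiple of |x|^2. It is
   bounded below along a convergent subsequence, so x -> 0; then g, Ay, y, l and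
   the residuals Au - z, Pu - v tend to 0, and the optimality conditions of the
   subproblems pass to the limit. *)

(** * The real inner product on complex vectors *)

Section InnerProduct.
Set Implicit Arguments.
Unset Strict Implicit.
Variable R : realType.
Implicit Types k m : nat.

Lemma Re_sum k (F : 'I_k -> R[i]) :
  complex.Re (\sum_j F j) = \sum_j complex.Re (F j).
Proof. by apply: (big_morph _ _ (erefl _)) => -[a b] [c d]. Qed.

Lemma rinnerE k (a b : 'cV[R[i]]_k) : rinner a b =
  \sum_j (complex.Re (a j 0) * complex.Re (b j 0)
        + complex.Im (a j 0) * complex.Im (b j 0)).
Proof.
rewrite /rinner Re_sum; apply: eq_bigr => j _; rewrite /cconj.
by case: (a j 0) => x y; case: (b j 0) => z t /=; ring.
Qed.

Lemma rinnerC k (a b : 'cV[R[i]]_k) : rinner a b = rinner b a.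
Proof. by rewrite !rinnerE; apply: eq_bigr => j _; ring. Qed.

Lemma rinnerDl k (a b c : 'cV[R[i]]_k) :
  rinner (a + b) c = rinner a c + rinner b c.
Proof.
rewrite !rinnerE -big_split; apply: eq_bigr => j _ /=; rewrite mxE.
by case: (a j 0) => ? ?; case: (b j 0) => ? ? /=; ring.
Qed.

Lemma rinnerNl k (a b : 'cV[R[i]]_k) : rinner (- a) b = - rinner a b.
Proof.
rewrite !rinnerE -sumrN; apply: eq_bigr => j _ /=; rewrite mxE.
by case: (a j 0) => ? ? /=; ring.
Qed.

Lemma rinnerZl k (t : R) (a b : 'cV[R[i]]_k) :
  rinner (t%:C *: a) b = t * rinner a b.
Proof.
rewrite !rinnerE mulr_sumr; apply: eq_bigr => j _ /=; rewrite mxE.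
by case: (a j 0) => ? ? /=; ring.
Qed.

Lemma rinnerDr k (a b c : 'cV[R[i]]_k) :
  rinner c (a + b) = rinner c a + rinner c b.
Proof. by rewrite rinnerC rinnerDl !(rinnerC c). Qed.

Lemma rinnerNr k (a b : 'cV[R[i]]_k) : rinner a (- b) = - rinner a b.
Proof. by rewrite rinnerC rinnerNl rinnerC. Qed.

Lemma rinnerZr k (t : R) (a b : 'cV[R[i]]_k) :
  rinner a (t%:C *: b) = t * rinner a b.
Proof. by rewrite rinnerC rinnerZl rinnerC. Qed.

Lemma rinner0l k (a : 'cV[R[i]]_k) : rinner 0 a = 0.
Proof. by rewrite -(subrr a) rinnerDl rinnerNl subrr. Qed.

Lemma rinner0r k (a : 'cV[R[i]]_k) : rinner a 0 = 0.
Proof. by rewrite rinnerC rinner0l. Qed.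

Definition rinner_lin := (@rinnerDl, @rinnerDr, @rinnerNl, @rinnerNr).

Lemma sqr_cabs (z : R[i]) : cabs z ^+ 2 = complex.Re z ^+ 2 + complex.Im z ^+ 2.
Proof. by rewrite /cabs sqr_sqrtr // addr_ge0 ?sqr_ge0. Qed.

Lemma sqr_vnorm k (a : 'cV[R[i]]_k) : vnorm a ^+ 2 = rinner a a.
Proof.
rewrite /vnorm sqr_sqrtr; last by apply: sumr_ge0 => j _; exact: sqr_ge0.
by rewrite rinnerE; apply: eq_bigr => j _; rewrite sqr_cabs !expr2.
Qed.

Lemma vnorm_ge0 k (a : 'cV[R[i]]_k) : 0 <= vnorm a.
Proof. exact: sqrtr_ge0. Qed.

Lemma rinner_ge0 k (a : 'cV[R[i]]_k) : 0 <= rinner a a.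
Proof. by rewrite -sqr_vnorm sqr_ge0. Qed.

Lemma rinner_eq0 k (a : 'cV[R[i]]_k) : rinner a a = 0 -> a = 0.
Proof.
rewrite rinnerE => /eqP; rewrite psumr_eq0 => [|j _]; last first.
  by rewrite -!expr2 addr_ge0 ?sqr_ge0.
move=> /allP a0; apply/matrixP => j l; rewrite (ord1 l) mxE.
have := a0 j (mem_index_enum _); case: (a j 0) => x y /=.
rewrite -!expr2 paddr_eq0 ?sqr_ge0// !sqrf_eq0 => /andP[/eqP-> /eqP->].
by [].
Qed.

Lemma vnorm_eq0 k (a : 'cV[R[i]]_k) : vnorm a = 0 -> a = 0.
Proof. by move=> a0; apply: rinner_eq0; rewrite -sqr_vnorm a0 expr0n. Qed.

Lemma vnorm0 k : vnorm (0 : 'cV[R[i]]_k) = 0.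
Proof. by apply/eqP; rewrite -sqrf_eq0 sqr_vnorm rinner0l. Qed.

Lemma vnormN k (a : 'cV[R[i]]_k) : vnorm (- a) = vnorm a.
Proof.
by apply/eqP; rewrite -(@eqrXn2 _ 2) ?vnorm_ge0// !sqr_vnorm rinnerNl rinnerNr opprK.
Qed.

Lemma vnormZ k (t : R) (a : 'cV[R[i]]_k) : vnorm (t%:C *: a) = `|t| * vnorm a.
Proof.
apply/eqP; rewrite -(@eqrXn2 _ 2) ?mulr_ge0 ?vnorm_ge0//.
by rewrite exprMn !sqr_vnorm rinnerZl rinnerZr real_normK ?num_real// mulrA -expr2.
Qed.

Lemma rinner_le_vnorm k (a b : 'cV[R[i]]_k) : rinner a b <= vnorm a * vnorm b.
Proof.
have [b0|bn0] := eqVneq (vnorm b) 0.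
  by rewrite (vnorm_eq0 b0) rinner0r vnorm0 mulr0.
have [a0|an0] := eqVneq (vnorm a) 0.
  by rewrite (vnorm_eq0 a0) rinner0l vnorm0 mul0r.
have bp : 0 < vnorm b by rewrite lt_neqAle eq_sym bn0 vnorm_ge0.
have ap : 0 < vnorm a by rewrite lt_neqAle eq_sym an0 vnorm_ge0.
have := rinner_ge0 ((vnorm b)%:C *: a - (vnorm a)%:C *: b).
rewrite !rinner_lin !rinnerZl !rinnerZr (rinnerC b a) -!sqr_vnorm => h.
have : 0 <= 2 * (vnorm a * vnorm b) * (vnorm a * vnorm b - rinner a b) by lra.
by rewrite pmulr_rge0 ?subr_ge0// !mulr_gt0.
Qed.

Lemma vnormD k (a b : 'cV[R[i]]_k) : vnorm (a + b) <= vnorm a + vnorm b.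
Proof.
rewrite -(@ler_pXn2r _ 2) ?nnegrE ?addr_ge0 ?vnorm_ge0// sqr_vnorm.
rewrite !rinner_lin (rinnerC b a) -!sqr_vnorm.
have := rinner_le_vnorm a b; lra.
Qed.

Lemma rinner_adj m k (M : 'M[R[i]]_(m, k)) a b :
  rinner (M *m a) b = rinner a (adj M *m b).
Proof.
rewrite /rinner; congr complex.Re.
have cconjM (x y : R[i]) : cconj (x * y) = cconj x * cconj y.
  by case: x => x1 x2; case: y => y1 y2; rewrite /cconj; simpc; congr (_ +i* _); ring.
have cconj_sum n (F : 'I_n -> R[i]) : cconj (\sum_j F j) = \sum_j cconj (F j).
  apply: (big_morph _ _) => [[x1 x2] [y1 y2]|]; rewrite /cconj /=; last by rewrite oppr0.
  by apply/eqP; rewrite eq_complex /= eqxx opprD /=.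
under eq_bigr do rewrite mxE mulr_suml.
rewrite exchange_big; apply: eq_bigr => j _ /=; rewrite mxE cconj_sum mulr_sumr.
apply: eq_bigr => i _; rewrite mxE cconjM.
have -> : cconj (cconj (M i j)) = M i j.
  by case: (M i j) => x y; rewrite /cconj /= opprK.
ring.
Qed.

(** The real and imaginary parts of each entry of [M *m h] are real inner products of [h] with [e i]
    and [e' i], so Cauchy-Schwarz applies row by row. This bounds the set whose supremum is
    [opnorm M], which would otherwise be a default value. *)
Lemma mulmx_bounded m k (M : 'M[R[i]]_(m, k)) :
  exists2 K : R, 0 <= K & forall h, vnorm (M *m h) <= K * vnorm h.
Proof.
pose e i : 'cV[R[i]]_k := \col_j cconj (M i j).
pose e' i : 'cV[R[i]]_k := \col_j ('i * cconj (M i j)).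
exists (Num.sqrt (\sum_i (vnorm (e i) ^+ 2 + vnorm (e' i) ^+ 2))) => [|h].
  exact: sqrtr_ge0.
have sumge0 : 0 <= \sum_i (vnorm (e i) ^+ 2 + vnorm (e' i) ^+ 2).
  by apply: sumr_ge0 => i _; rewrite addr_ge0 ?sqr_ge0.
rewrite -(@ler_pXn2r _ 2) ?nnegrE ?mulr_ge0 ?sqrtr_ge0 ?vnorm_ge0//.
rewrite exprMn (sqr_sqrtr sumge0) mulr_suml sqr_vnorm rinnerE.
apply: ler_sum => i _.
have -> : complex.Re ((M *m h) i 0) = rinner h (e i).
  rewrite /rinner mxE; congr complex.Re; apply: eq_bigr => j _; rewrite mxE.
  case: (M i j) => x y; case: (h j 0) => z t; rewrite /cconj.
  by apply/eqP; rewrite eq_complex /=; apply/andP; split; apply/eqP; ring.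
have -> : complex.Im ((M *m h) i 0) = rinner h (e' i).
  rewrite rinnerE mxE.
  have Im_sum n (F : 'I_n -> R[i]) : complex.Im (\sum_j F j) = \sum_j complex.Im (F j).
    by apply: (big_morph _ _ (erefl _)) => -[? ?] [? ?].
  rewrite Im_sum; apply: eq_bigr => j _; rewrite mxE.
  by case: (M i j) => x y; case: (h j 0) => z t; rewrite /cconj /=; ring.
have sq (a b : 'cV[R[i]]_k) : rinner a b ^+ 2 <= vnorm b ^+ 2 * vnorm a ^+ 2.
  have h1 := rinner_le_vnorm a b; have := rinner_le_vnorm (- a) b.
  rewrite vnormN rinnerNl => h2.
  have := vnorm_ge0 a; have := vnorm_ge0 b => a0 b0.
  rewrite -exprMn -[_ ^+ 2]real_normK ?num_real// ler_pXn2r ?nnegrE ?mulr_ge0//.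
  by rewrite ler_norml mulrC h1 andbT lerNl.
by rewrite -!expr2 mulrDl lerD.
Qed.

Lemma le_opnorm m k (M : 'M[R[i]]_(m, k)) h :
  vnorm (M *m h) <= opnorm M * vnorm h.
Proof.
have [K K0 MK] := mulmx_bounded M.
have ubM : has_sup [set vnorm (M *m h) | h in [set h | vnorm h <= 1]]%classic.
  split; first by exists (vnorm (M *m 0)), 0 => //=; rewrite vnorm0 ler01.
  exists K => _ [g /= g1 <-]; apply: (le_trans (MK g)).
  by rewrite ler_piMr.
have [h0|hn0] := eqVneq (vnorm h) 0.
  by rewrite (vnorm_eq0 h0) mulmx0 !vnorm0 mulr0.
have hp : 0 < vnorm h by rewrite lt_neqAle eq_sym hn0 vnorm_ge0.
rewrite -ler_pdivrMr// mulrC.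
have -> : (vnorm h)^-1 * vnorm (M *m h) = vnorm (M *m ((vnorm h)^-1%:C *: h)).
  by rewrite -scalemxAr vnormZ gtr0_norm ?invr_gt0.
apply: sup_upper_bound => //=; exists ((vnorm h)^-1%:C *: h) => //=.
by rewrite vnormZ gtr0_norm ?invr_gt0// mulVf.
Qed.

Lemma sqr_mulmx_le_opnorm m k (A : 'M[R[i]]_(m, k)) h :
  rinner (A *m h) (A *m h) <= opnorm (adj A *m A) * rinner h h.
Proof.
rewrite rinner_adj mulmxA (le_trans (rinner_le_vnorm _ _))//.
rewrite -sqr_vnorm expr2 mulrCA ler_wpM2l ?vnorm_ge0//; exact: le_opnorm.
Qed.

End InnerProduct.

(** * The truncated amplitude metric *)

Section Metric.
Set Implicit Arguments.
Unset Strict Implicit.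
Variables (R : realType) (eps : R).
Hypothesis eps01 : 0 < eps < 1.
Let eps0 : 0 < eps. Proof. by case/andP: eps01. Qed.
Let eps1 : eps < 1. Proof. by case/andP: eps01. Qed.

(* [|x|^2/2 - geps x b] is, up to a constant, a Huber function; its gradient
   [huber_coef x b * x] is [eps^-1] times the projection of [x] on the disk of
   radius [eps * sqrt b]. At [x = 0], [b = 0] the coefficient is the junk value
   [0 / 0 = 0], which is harmless. *)
Definition huber_coef (x : R[i]) (b : R) : R :=
  if cabs x < eps * Num.sqrt b then eps^-1 else Num.sqrt b / cabs x.

Definition huber_grad m (f : 'cV[R]_m) (z : 'cV[R[i]]_m) : 'cV[R[i]]_m :=
  \col_j ((huber_coef (z j 0) (f j 0))%:C * z j 0).

Lemma cabs_ge0 (x : R[i]) : 0 <= cabs x.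
Proof. exact: sqrtr_ge0. Qed.

Lemma huber_coef_ge0 x b : 0 <= huber_coef x b.
Proof.
rewrite /huber_coef; case: ifP => _; first by rewrite invr_ge0 ltW.
by rewrite divr_ge0 ?sqrtr_ge0.
Qed.

Lemma huber_coef_cabs_le x b : huber_coef x b * cabs x <= Num.sqrt b.
Proof.
rewrite /huber_coef; case: ifPn => [/ltW xb|_]; first by rewrite ler_pdivrMl.
have [->|x0] := eqVneq (cabs x) 0; first by rewrite mulr0 sqrtr_ge0.
by rewrite divfK.
Qed.

Lemma huber_coef_out x b : ~~ (cabs x < eps * Num.sqrt b) ->
  huber_coef x b * cabs x = Num.sqrt b.
Proof.
move=> xb; rewrite /huber_coef (negbTE xb); move: xb; rewrite -leNgt.
have [->|x0 _] := eqVneq (cabs x) 0; last by rewrite divfK.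
(* The point [x = 0] lies outside the open disk only when [sqrt b = 0], so both sides vanish. *)
rewrite mulr0 pmulr_rle0// => b0; apply/eqP.
by rewrite eq_le b0 sqrtr_ge0.
Qed.

(** Both branches are [|x|^2/2] minus the maximum over [|q| <= sqrt b] of [<q, x> - eps/2 |q|^2], up
    to a constant; the maximizer is [huber_coef x b * x]. This single formula makes the later
    estimates free of case analysis. *)
Lemma gepsE x b : 0 <= b ->
  geps eps x b = cabs x ^+ 2 / 2 - huber_coef x b * cabs x ^+ 2
    + eps / 2 * (huber_coef x b * cabs x) ^+ 2 + (1 - eps) / 2 * b.
Proof.
move=> b0; have [xb|xb] := boolP (cabs x < eps * Num.sqrt b).
  by rewrite /geps /huber_coef xb; field; rewrite gt_eqF.
rewrite huber_coef_out// /geps (negbTE xb).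
have -> : huber_coef x b * cabs x ^+ 2 = Num.sqrt b * cabs x.
  by rewrite -(huber_coef_out xb); ring.
by move: (Num.sqrt b) (sqr_sqrtr b0) => s <-; field.
Qed.

Lemma geps_ge0 x b : 0 <= b -> 0 <= geps eps x b.
Proof.
move=> b0; rewrite /geps; case: ifP => xb; last first.
  by rewrite mulr_ge0 ?invr_ge0 ?sqr_ge0.
rewrite mulr_ge0 ?divr_ge0 ?subr_ge0 ?(ltW eps1)// -(sqr_sqrtr b0).
rewrite ler_pdivrMl//; have := cabs_ge0 x; have := sqrtr_ge0 b.
move: (Num.sqrt b) (cabs x) xb => s t ts s0 t0.
have : t ^+ 2 <= (eps * s) ^+ 2 by rewrite ler_pXn2r ?nnegrE ?mulr_ge0 ?(ltW eps0) ?(ltW ts).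
move/le_trans; apply; rewrite exprMn ler_wpM2r ?sqr_ge0// expr2.
by rewrite ler_piMl ?(ltW eps0) ?(ltW eps1).
Qed.

Lemma cdot_le_cabs (x y : R[i]) :
  complex.Re x * complex.Re y + complex.Im x * complex.Im y <= cabs x * cabs y.
Proof.
apply: (le_trans (ler_norm _)).
rewrite -(@ler_pXn2r _ 2) ?nnegrE ?mulr_ge0 ?cabs_ge0 ?normr_ge0//.
rewrite real_normK ?num_real// exprMn !sqr_cabs -subr_ge0.
have -> : (complex.Re x ^+ 2 + complex.Im x ^+ 2) * (complex.Re y ^+ 2 + complex.Im y ^+ 2) -
  (complex.Re x * complex.Re y + complex.Im x * complex.Im y) ^+ 2 =
  (complex.Re x * complex.Im y - complex.Im x * complex.Re y) ^+ 2 by ring.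
exact: sqr_ge0.
Qed.

(* The projection inequality, with the vector [x - eps p(x)] written as
   [(1 - eps * huber_coef x b) * x]. *)
Lemma huber_normal_cone (x y : R[i]) b :
  (1 - eps * huber_coef x b) *
  (huber_coef y b * (complex.Re y * complex.Re x + complex.Im y * complex.Im x)
   - huber_coef x b * cabs x ^+ 2) <= 0.
Proof.
have [xb|xb] := boolP (cabs x < eps * Num.sqrt b).
  by rewrite {1}/huber_coef xb divff ?gt_eqF// subrr mul0r.
(* Outside the open disk, [eps * huber_coef x b <= 1], and the maximizer at [x] has the largest
   modulus allowed, [sqrt b], in the direction of [x]; Cauchy-Schwarz bounds the one at [y]. *)
rewrite mulr_ge0_le0//.
  rewrite /huber_coef (negbTE xb) subr_ge0.
  have [->|x0] := eqVneq (cabs x) 0; first by rewrite invr0 !mulr0 ler01.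
  rewrite mulrA ler_pdivrMr ?mul1r ?lt_neqAle 1?eq_sym ?x0 ?cabs_ge0//.
  by rewrite leNgt.
rewrite subr_le0 expr2 mulrA huber_coef_out//.
apply: (le_trans (ler_wpM2l (huber_coef_ge0 y b) (cdot_le_cabs y x))).
by rewrite mulrA ler_wpM2r ?cabs_ge0 ?huber_coef_cabs_le.
Qed.

Variables (m : nat) (f : 'cV[R]_m).
Hypothesis f0 : forall k, 0 <= f k 0.
Local Notation p := (huber_grad f).
Local Notation G := (fun z => Geps eps z f).

Lemma GepsE z : Geps eps z f = rinner z z / 2 - rinner (p z) z
  + eps / 2 * rinner (p z) (p z) + (1 - eps) / 2 * \sum_j f j 0.
Proof.
rewrite /Geps !rinnerE !mulr_suml !mulr_sumr -sumrB -!big_split /=.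
apply: eq_bigr => j _; rewrite gepsE// exprMn sqr_cabs !mxE.
by case: (z j 0) => x y /=; ring.
Qed.

Lemma Geps_ge0 z : 0 <= Geps eps z f.
Proof. by apply: sumr_ge0 => j _; exact: geps_ge0. Qed.

Lemma huber_grad_normal_cone z y : rinner (p y - p z) (z - eps%:C *: p z) <= 0.
Proof.
rewrite rinnerE; apply: sumr_le0 => j _.
apply: le_trans (huber_normal_cone (z j 0) (y j 0) (f j 0)).
rewrite le_eqVlt; apply/orP; left; apply/eqP; rewrite !mxE sqr_cabs.
by case: (z j 0) => x1 x2; case: (y j 0) => y1 y2 /=; ring.
Qed.

(** The sum of the projection inequalities at [z] and at [y]: firm nonexpansiveness of a projection,
    rescaled by [eps]. *)
Lemma huber_grad_cocoercive z y :
  eps * rinner (p y - p z) (p y - p z) <= rinner (p y - p z) (y - z).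
Proof.
have := huber_grad_normal_cone z y; have := huber_grad_normal_cone y z.
rewrite !rinner_lin !rinnerZr (rinnerC (p z) (p y)); lra.
Qed.

(** [G] minus [|.|^2/2] is concave: by the projection inequality at [y], the gap is at least
    [eps/2 |p y - p z|^2]. *)
Lemma Geps_upper z y :
  G y <= G z + rinner (z - p z) (y - z) + rinner (y - z) (y - z) / 2.
Proof.
have := huber_grad_normal_cone y z.
have := mulr_ge0 (ltW eps0) (rinner_ge0 (p y - p z)).
rewrite !GepsE !rinner_lin !rinnerZr (rinnerC (p z) (p y)) (rinnerC z y); lra.
Qed.

(** Weak convexity: the Huber part has an [eps^-1]-Lipschitz gradient, and half of its quadratic
    gain offsets the curvature. The projection inequality at [z] leaves a term in [p y - p z],
    absorbed by completing the square. *)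
Lemma Geps_lower z y :
  G z + rinner (z - p z) (y - z) - (eps^-1 - 1) / 2 * rinner (y - z) (y - z)
  <= G y.
Proof.
have := huber_grad_normal_cone z y.
have : 0 <= eps / 2 * rinner (p y - p z) (p y - p z) - rinner (p y - p z) (y - z)
          + eps^-1 / 2 * rinner (y - z) (y - z).
  move: (p y - p z) (y - z) => q d; have := rinner_ge0 (eps%:C *: q - d).
  rewrite !rinner_lin !rinnerZl !rinnerZr (rinnerC d q) => h.
  have e0 : 0 <= eps^-1 / 2 by rewrite divr_ge0 ?invr_ge0 ?ltW.
  apply: le_trans (mulr_ge0 e0 h) _; rewrite le_eqVlt; apply/orP; left.
  by apply/eqP; field; rewrite gt_eqF.
rewrite !GepsE !rinner_lin !rinnerZr (rinnerC (p z) (p y)) (rinnerC z y); lra.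
Qed.

Lemma Geps_grad_lipschitz z y :
  rinner ((y - p y) - (z - p z)) ((y - p y) - (z - p z))
  <= eps^-1 ^+ 2 * rinner (y - z) (y - z).
Proof.
have -> : (y - p y) - (z - p z) = (y - z) - (p y - p z).
  by rewrite !opprD !opprK addrACA.
have := huber_grad_cocoercive z y.
move: (y - z) (p y - p z) => d q coc.
have := rinner_ge0 (d - eps%:C *: q); have := rinner_ge0 q; have := rinner_ge0 d.
rewrite !rinner_lin !rinnerZl !rinnerZr (rinnerC d q).
move: coc; move: (rinner d d) (rinner q d) (rinner q q) => D M Q coc D0 Q0 h.
set c := eps^-1.
have ec : eps * c = 1 by rewrite /c divff ?gt_eqF.
have c1 : 1 < c by rewrite /c invf_gt1.
have QD : Q <= c ^+ 2 * D.
  have : 0 <= c ^+ 2 * (D - eps ^+ 2 * Q) 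
    by rewrite mulr_ge0 ?sqr_ge0//; have := ler_wpM2l (ltW eps0) coc; lra.
  have -> : c ^+ 2 * (D - eps ^+ 2 * Q) = c ^+ 2 * D - (eps * c) ^+ 2 * Q by ring.
  by rewrite ec; lra.
have c2D : D <= c ^+ 2 * D by rewrite ler_peMl// exprn_ege1// ltW.
(* Cocoercivity gives [|d - q|^2 <= D + (1 - 2 eps) Q]; the sign of [1 - 2 eps] decides whether the
   last term is discarded or bounded through [Q <= c^2 D]. *)
have [e2|e2] := leP 1 (2 * eps).
  have : 0 <= (2 * eps - 1) * Q by rewrite mulr_ge0// subr_ge0.
  lra.
have : (1 - 2 * eps) * Q <= (1 - 2 * eps) * (c ^+ 2 * D) by rewrite ler_wpM2l//; lra.
have -> : (1 - 2 * eps) * (c ^+ 2 * D) = c ^+ 2 * D - 2 * (c * D).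
  have -> : c ^+ 2 * D - 2 * (c * D) = c ^+ 2 * D - 2 * (eps * c) * c * D.
    by rewrite ec; ring.
  by ring.
have : D <= c * D by rewrite ler_peMl// ltW.
lra.
Qed.

End Metric.

(** * First-order condition from a one-variable quadratic bound *)

Section Minimizers.
Set Implicit Arguments.
Unset Strict Implicit.
Variable R : realType.

Lemma linear_coef_eq0 (a b : R) : (forall t, 0 <= t * a + t ^+ 2 * b) -> a = 0.
Proof.
move=> h; pose B := `|b| + 1.
have B0 : 0 < B by rewrite ltr_wpDl.
have bB : b <= B by rewrite (le_trans (ler_norm b))// lerDl.
(* This point minimizes [t a + t^2 B], with value [- a^2 / (4 B)]. *)
have := h (- a / (2 * B)).
have := ler_wpM2l (sqr_ge0 (- a / (2 * B))) bB.
have -> : (- a / (2 * B)) ^+ 2 * B = a ^+ 2 / (4 * B) by field; rewrite gt_eqF.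
have -> : - a / (2 * B) * a = - (2 * (a ^+ 2 / (4 * B))) by field; rewrite gt_eqF.
move=> h1 h2; have : a ^+ 2 / (4 * B) <= 0 by lra.
rewrite ler_pdivrMr ?mul0r ?mulr_gt0// => a2.
by apply/eqP; rewrite -sqrf_eq0 eq_le a2 sqr_ge0.
Qed.

End Minimizers.

(** * One step of one block *)

Section Block.
Set Implicit Arguments.
Unset Strict Implicit.
Variables (R : realType) (eps r eta : R) (n nh m : nat).
Variables (A : 'M[R[i]]_(m, n)) (P : 'M[R[i]]_(nh, n)) (f : 'cV[R]_m).
Hypotheses (eps01 : 0 < eps < 1) (r0 : 0 < r) (eta0 : 0 < eta).
Hypothesis f0 : forall k, 0 <= f k 0.
Local Notation p := (huber_grad eps f).
Local Notation G := (fun z => Geps eps z f).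
Local Notation c := eps^-1.

(** The share of one subdomain: for a common [v] the full Lagrangian is the sum of two such terms,
    so most estimates are made once per block. *)
Definition block_lagrangian (u : 'cV_n) (v : 'cV_nh) (z : 'cV_m)
    (La : 'cV_nh) (Ga : 'cV_m) : R :=
  Geps eps z f + r * (rinner La (P *m u - v) + 2^-1 * vnorm (P *m u - v) ^+ 2)
    + eta * (rinner Ga (A *m u - z) + 2^-1 * vnorm (A *m u - z) ^+ 2).

(** The new [v'] is a parameter, since its update couples the two blocks. *)
Record block_step (u u' : 'cV_n) (v' : 'cV_nh) (z' : 'cV_m)
    (La La' : 'cV_nh) (Ga Ga' : 'cV_m) : Prop := BlockStep {
  step_z : forall z, G z' + eta / 2 * vnorm (z' - (Ga + A *m u)) ^+ 2
                  <= G z + eta / 2 * vnorm (z - (Ga + A *m u)) ^+ 2;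
  step_Ga : Ga' = Ga + A *m u - z';
  step_u : forall w,
    eta / 2 * vnorm (A *m u' + Ga' - z') ^+ 2 + r / 2 * vnorm (P *m u' - v' + La) ^+ 2
    <= eta / 2 * vnorm (A *m w + Ga' - z') ^+ 2 + r / 2 * vnorm (P *m w - v' + La) ^+ 2;
  step_La : La' = La + P *m u' - v' }.

Section OneStep.
Variables (u u' : 'cV[R[i]]_n) (v v' : 'cV[R[i]]_nh) (z z' : 'cV[R[i]]_m).
Variables (La La' : 'cV[R[i]]_nh) (Ga Ga' : 'cV[R[i]]_m).
Hypothesis st : block_step u u' v' z' La La' Ga Ga'.

(** The first variation, with [Geps_upper] in place of differentiability of [G]: its [1/2] and the
    penalty's [eta/2] make up the quadratic coefficient. The dual update turns the penalty gradient
    into [- eta Ga']. *)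
Lemma step_z_opt h : rinner (z' - p z') h = eta * rinner Ga' h.
Proof.
apply/eqP; rewrite -subr_eq0; apply/eqP.
apply: (@linear_coef_eq0 _ _ ((1 + eta) / 2 * rinner h h)) => t.
have := step_z st (z' + t%:C *: h).
have := Geps_upper eps01 f0 z' (z' + t%:C *: h).
rewrite (step_Ga st) !sqr_vnorm; move: (A *m u) => a.
rewrite [z' + _ - z']addrC addKr !rinner_lin !rinnerZl !rinnerZr.
rewrite !(rinnerC h) (rinnerC a Ga) (rinnerC a z') (rinnerC Ga z'); lra.
Qed.

Lemma step_u_opt h :
  eta * rinner (Ga' + A *m u' - z') (A *m h) + r * rinner La' (P *m h) = 0.
Proof.
apply: (@linear_coef_eq0 _ _ (eta / 2 * rinner (A *m h) (A *m h)
  + r / 2 * rinner (P *m h) (P *m h))) => t.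
have := step_u st (u' + t%:C *: h); rewrite (step_La st) !sqr_vnorm.
rewrite !mulmxDr -!scalemxAr.
move: (A *m u') (A *m h) (P *m u') (P *m h) => a b q s.
rewrite !rinner_lin !rinnerZl !rinnerZr !(rinnerC b) !(rinnerC s).
rewrite (rinnerC Ga' a) (rinnerC z' a) (rinnerC z' Ga').
rewrite (rinnerC v' q) (rinnerC La q) (rinnerC La v'); lra.
Qed.

(* The cost of the two dual updates is [eta |Ga' - Ga|^2 + r |La' - La|^2];
   the [r / 2] bracket is the effect of the [v]-update on this block. *)
Lemma block_lagrangian_step :
  block_lagrangian u' v' z' La' Ga' <= block_lagrangian u v z La Ga
  + r / 2 * (rinner (P *m u + La - v') (P *m u + La - v')
           - rinner (P *m u + La - v) (P *m u + La - v))
  - ((eta + 1 - c) / 2 * rinner (z' - z) (z' - z)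
     - eta * rinner (Ga' - Ga) (Ga' - Ga)
     + eta / 2 * rinner (A *m u' - A *m u) (A *m u' - A *m u)
     + r / 2 * rinner (P *m u' - P *m u) (P *m u' - P *m u)
     - r * rinner (La' - La) (La' - La)).
Proof.
(* Weak convexity loses [(c - 1)/2 |z' - z|^2] against the gain [eta/2 |z' - z|^2] of the penalty;
   testing [step_u_opt] with [u - u'] gives the exact gain of the quadratic [u]-problem. *)
have := Geps_lower eps01 f0 z' z; rewrite step_z_opt.
have := step_u_opt (u - u'); rewrite mulmxBr mulmxBr.
rewrite /block_lagrangian (step_La st) (step_Ga st) !sqr_vnorm.
move: (A *m u) (A *m u') (P *m u) (P *m u') => a a' q q'.
rewrite !rinner_lin.
rewrite (rinnerC z' z) !(rinnerC a') !(rinnerC a) (rinnerC Ga z) (rinnerC Ga z').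
rewrite !(rinnerC q') !(rinnerC q) (rinnerC La v) (rinnerC La v').
rewrite ?(rinnerC v' v); lra.
Qed.

End OneStep.

(** Test with [h = P^* K], so that [P h = K] and [|h| = |K|]. For [B = A h] the assumption on [r]
    gives [eta |B|^2 <= r/2 |K|^2], and [|W + 2B|^2 >= 0] bounds the cross term. *)
Lemma dual_le (W : 'cV[R[i]]_m) (K : 'cV[R[i]]_nh) :
  (forall h : 'cV[R[i]]_nh, P *m (adj P *m h) = h) ->
  2 * eta * opnorm (adj A *m A) <= r ->
  (forall h, eta * rinner W (A *m h) + r * rinner K (P *m h) = 0) ->
  r * rinner K K <= eta / 2 * rinner W W.
Proof.
move=> PP Mr /(_ (adj P *m K)).
rewrite PP.
have := sqr_mulmx_le_opnorm A (adj P *m K).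
rewrite -rinner_adj PP.
move: (A *m (adj P *m K)) => B BK.
have : eta * rinner B B <= r / 2 * rinner K K.
  apply: le_trans (ler_wpM2l (ltW eta0) BK) _.
  rewrite mulrA ler_wpM2r ?rinner_ge0//; lra.
have := mulr_ge0 (ltW eta0) (rinner_ge0 (W + B + B)).
rewrite !rinner_lin !(rinnerC B W); lra.
Qed.

(** What remains of the coefficient of [|x'|^2] in [block_dissipation]: [5/3] collects the bounds on
    [eta |g|^2], [c/3] comes from Young's inequality, and the last term is paid to the telescoping
    [|x|^2]. *)
Definition decay_coef : R :=
  (eta + 1 - c) / 2 - 5 / 3 * (c ^+ 2 / eta) - c / 3 - (eta + 2 * c) / 6.

Lemma decay_coef_gt0 :
  (eta - 3 * (2 / eps - 1)) / 2 - (2 / eps - 1) ^+ 2 / eta > 0 -> 0 < decay_coef.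
Proof.
have /andP[e0 e1] := eps01.
have c1 : 1 < c by rewrite invf_gt1.
rewrite /decay_coef; move: c c1 => d d1; set L := 2 * d - 1.
have -> : (eta - 3 * L) / 2 - L ^+ 2 / eta =
  (eta ^+ 2 - 3 * eta * L - 2 * L ^+ 2) / (2 * eta) by field; rewrite gt_eqF.
rewrite pmulr_lgt0 ?invr_gt0 ?mulr_gt0// /L => K.
have -> : (eta + 1 - d) / 2 - 5 / 3 * (d ^+ 2 / eta) - d / 3 - (eta + 2 * d) / 6
  = (2 * eta ^+ 2 + 3 * eta - 7 * d * eta - 10 * d ^+ 2) / (6 * eta).
  by field; rewrite gt_eqF.
rewrite divr_gt0 ?mulr_gt0//.
have etaL : 3 * (2 * d - 1) < eta.
  rewrite ltNge; apply/negP => h.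
  have : 0 <= eta * (3 * (2 * d - 1) - eta) by rewrite mulr_ge0 ?subr_ge0// ltW.
  have := sqr_ge0 (2 * d - 1); lra.
(* The numerator to be bounded equals twice the positive polynomial [K], plus this product, plus
   [(d - 1) (36 d - 13)]. *)
have : 0 <= (5 * d - 3) * (eta - 3 * (2 * d - 1)) by rewrite mulr_ge0//; lra.
have : 0 <= (d - 1) * (36 * d - 13) by rewrite mulr_ge0//; lra.
lra.
Qed.

(* Adds up [r |2q - (l' - l)|^2 >= 0], [eta |3w + x - 2g|^2 >= 0] and Young's
   inequality for [x - 2g] with weight [c / eta]; [l - l'] versus [l + l'] is
   traded by the parallelogram law, at the price of the telescoping term
   [|l'|^2 - |l|^2]. *)
Lemma block_dissipation (l l' q : 'cV[R[i]]_nh) (w x x' g : 'cV[R[i]]_m) :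
  eta ^+ 2 * rinner g g <= c ^+ 2 * rinner x' x' ->
  r * rinner (l' + l) (l' + l) <= eta / 2 * rinner (w - x + g + g) (w - x + g + g) ->
  decay_coef * rinner x' x'
    + (eta + 2 * c) / 6 * (rinner x' x' - rinner x x)
    - r / 2 * (rinner l' l' - rinner l l)
  <= (eta + 1 - c) / 2 * rinner x' x' - eta * rinner g g
     + eta / 2 * rinner w w + r / 2 * rinner q q - r * rinner l' l'
     + r / 2 * rinner (q - l' + l) (q - l' + l).
Proof.
have /andP[e0 e1] := eps01.
have c0 : 0 < c by rewrite invr_gt0.
rewrite /decay_coef; move: c c0 => d d0.
have := mulr_ge0 (ltW r0) (rinner_ge0 (q + q - (l' - l))).
have := mulr_ge0 (ltW eta0) (rinner_ge0 (w + w + w + x - (g + g))).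
have : 0 <= d * rinner x x + 2 * eta * rinner x g + eta ^+ 2 * rinner g g / d.
  have -> : d * rinner x x + 2 * eta * rinner x g + eta ^+ 2 * rinner g g / d
      = rinner (d%:C *: x + eta%:C *: g) (d%:C *: x + eta%:C *: g) / d.
    rewrite !rinner_lin !rinnerZl !rinnerZr (rinnerC g x).
    by field; rewrite gt_eqF.
  by rewrite divr_ge0 ?rinner_ge0 ?ltW.
rewrite !rinner_lin (rinnerC g x) !(rinnerC w) (rinnerC l' l) !(rinnerC q).
move: (rinner x' x') (rinner x x) (rinner g g) (rinner x g) => X' X GG XG.
move=> h1 h2 h3 gx h4.
have g1 : eta * GG <= d ^+ 2 / eta * X'.
  by rewrite mulrAC ler_pdivlMr//; apply: le_trans gx; rewrite le_eqVlt;
    apply/orP; left; apply/eqP; ring.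
have g2 : eta ^+ 2 * GG / d <= d * X'.
  by rewrite ler_pdivrMr//; apply: le_trans gx _; rewrite le_eqVlt;
    apply/orP; left; apply/eqP; ring.
lra.
Qed.

End Block.

(** * Convergence of vector sequences *)

Section VectorConvergence.
Import numFieldNormedType.Exports.
Set Implicit Arguments.
Unset Strict Implicit.
Variable R : realType.
Local Open Scope classical_set_scope.

(** Phrased by a real sequence of norms, the form in which [sdist] controls each component. *)
Definition vcvg k (a : nat -> 'cV[R[i]]_k) (l : 'cV[R[i]]_k) : Prop :=
  (fun j => vnorm (a j - l)) @ \oo --> (0 : R).

Lemma vcvg_le k (a : nat -> 'cV[R[i]]_k) l (F : nat -> R) :
  (forall j, vnorm (a j - l) <= F j) -> F @ \oo --> (0 : R) -> vcvg a l.
Proof.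
move=> aF F0; apply: (squeeze_cvgr _ (cvg_cst _) F0).
by near=> j; rewrite vnorm_ge0 aF.
Unshelve. all: by end_near. Qed.

Lemma vcvg_lipschitz k k' (a : nat -> 'cV[R[i]]_k) l
    (b : nat -> 'cV[R[i]]_k') l' (K : R) :
  (forall j, vnorm (b j - l') <= K * vnorm (a j - l)) -> vcvg a l -> vcvg b l'.
Proof.
move=> ba al; apply: vcvg_le ba _; rewrite -(mulr0 K).
exact: cvgM (cvg_cst _) al.
Qed.

Lemma vcvg_lipschitz_sqr k k' (a : nat -> 'cV[R[i]]_k) l
    (b : nat -> 'cV[R[i]]_k') l' (K : R) : 0 <= K ->
  (forall j, rinner (b j - l') (b j - l') <= K ^+ 2 * rinner (a j - l) (a j - l)) ->
  vcvg a l -> vcvg b l'.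
Proof.
move=> K0 ba; apply: (vcvg_lipschitz (K := K)) => j.
by rewrite -(@ler_pXn2r _ 2) ?nnegrE ?mulr_ge0 ?vnorm_ge0// exprMn !sqr_vnorm.
Qed.

Lemma vcvgD k (a b : nat -> 'cV[R[i]]_k) l l' :
  vcvg a l -> vcvg b l' -> vcvg (fun j => a j + b j) (l + l').
Proof.
move=> al bl; apply: (@vcvg_le _ _ _ (fun j => vnorm (a j - l) + vnorm (b j - l'))).
  by move=> j; rewrite opprD addrACA vnormD.
by rewrite -(addr0 (0 : R)); exact: cvgD.
Qed.

Lemma vcvgN k (a : nat -> 'cV[R[i]]_k) l :
  vcvg a l -> vcvg (fun j => - a j) (- l).
Proof.
by apply: (vcvg_lipschitz (K := 1)) => j; rewrite -opprD vnormN mul1r.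
Qed.

Lemma vcvg_mulmx m k (M : 'M[R[i]]_(m, k)) (a : nat -> 'cV[R[i]]_k) l :
  vcvg a l -> vcvg (fun j => M *m a j) (M *m l).
Proof.
have [K _ MK] := mulmx_bounded M.
by apply: (vcvg_lipschitz (K := K)) => j; rewrite -mulmxBr.
Qed.

Lemma vcvg_comp k (a : nat -> 'cV[R[i]]_k) l (phi : nat -> nat) :
  (forall j, (j <= phi j)%N) -> vcvg a l -> vcvg (fun j => a (phi j)) l.
Proof.
move=> phij al; apply: (cvg_comp phi _ _ al).
apply/cvgnyPge => N; near=> j; apply: leq_trans (phij j).
near: j; exact: nbhs_infty_ge.
Unshelve. all: by end_near. Qed.

Lemma vcvg_tail k (a : nat -> 'cV[R[i]]_k) l :
  vcvg (fun j => a j.+1) l -> vcvg a l.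
Proof. by move=> al; rewrite /vcvg -cvg_shiftS. Qed.

Lemma vcvg_unique k (a : nat -> 'cV[R[i]]_k) l l' :
  vcvg a l -> vcvg a l' -> l = l'.
Proof.
move=> al al'; apply/eqP; rewrite eq_sym -subr_eq0; apply/eqP/vnorm_eq0.
have := vcvgD al (vcvgN al'); rewrite /vcvg.
under eq_fun do rewrite subrr sub0r opprB.
by move/(cvg_unique _ (cvg_cst _)); apply; exact: Rhausdorff.
Qed.

Lemma vcvg_rinner k (a : nat -> 'cV[R[i]]_k) l h :
  vcvg a l -> (fun j => rinner (a j) h) @ \oo --> rinner l h.
Proof.
move=> al.
have alh : (fun j => vnorm (a j - l) * vnorm h) @ \oo --> (0 : R).
  by rewrite -(mul0r (vnorm h)); exact: cvgM al (cvg_cst _).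
have lo : (fun j => rinner l h - vnorm (a j - l) * vnorm h) @ \oo --> rinner l h.
  by rewrite -[X in _ --> X]subr0; apply: cvgB alh; exact: cvg_cst.
have up : (fun j => rinner l h + vnorm (a j - l) * vnorm h) @ \oo --> rinner l h.
  by rewrite -[X in _ --> X]addr0; apply: cvgD alh; exact: cvg_cst.
apply: (squeeze_cvgr _ lo up); near=> j; apply/andP; split.
  have := rinner_le_vnorm (- (a j - l)) h; rewrite vnormN !rinner_lin; lra.
have := rinner_le_vnorm (a j - l) h; rewrite !rinner_lin; lra.
Unshelve. all: by end_near. Qed.

Lemma vcvg0_sqr k (a : nat -> 'cV[R[i]]_k) :
  (fun j => rinner (a j) (a j)) @ \oo --> (0 : R) -> vcvg a 0.
Proof.
move=> al; rewrite /vcvg.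
have -> : (fun j => vnorm (a j - 0)) = (fun j => Num.sqrt (rinner (a j) (a j))).
  by apply: boolp.funext => j; rewrite subr0 -sqr_vnorm sqrtr_sqr ger0_norm ?vnorm_ge0.
by rewrite -(@sqrtr0 R); apply: (continuous_cvg _ (@sqrt_continuous R 0)).
Qed.

(** [Phi] is nonincreasing, so a lower bound at arbitrarily late indices holds everywhere. Thus
    [Phi] converges, and [q] is squeezed by its consecutive differences. *)
Lemma decrease_cvg0 (Phi q : nat -> R) (C : R) : (forall j, 0 <= q j) ->
  (forall j, Phi j.+1 + q j <= Phi j) ->
  (forall j, exists2 l, (j <= l)%N & - C <= Phi l) -> q @ \oo --> (0 : R).
Proof.
move=> q0 dec low.
have noninc : {homo Phi : j l / (j <= l)%N >-> l <= j}.
  apply/nonincreasing_seqP => j; apply: le_trans (dec j); by rewrite lerDl.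
have cvPhi : cvgn Phi.
  apply: nonincreasing_is_cvgn => //; exists (- C) => _ [j _ <-].
  by have [l jl /le_trans] := low j; apply; exact: noninc.
have cvPhi1 : (fun j => Phi j.+1) @ \oo --> limn Phi by rewrite cvg_shiftS.
have : (fun j => Phi j - Phi j.+1) @ \oo --> (0 : R).
  by rewrite -(subrr (limn Phi)); exact: cvgB.
apply: squeeze_cvgr (cvg_cst _); near=> j.
by rewrite q0 lerBrDl dec.
Unshelve. all: by end_near. Qed.

End VectorConvergence.

(** * The iterates of one block *)

Section BlockSequence.
Set Implicit Arguments.
Unset Strict Implicit.
Import numFieldNormedType.Exports.
Local Open Scope classical_set_scope.
Variables (R : realType) (eps r eta : R) (n nh m : nat).
Variables (A : 'M[R[i]]_(m, n)) (P : 'M[R[i]]_(nh, n)) (f : 'cV[R]_m).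
Hypotheses (eps01 : 0 < eps < 1) (r0 : 0 < r) (eta0 : 0 < eta).
Hypothesis f0 : forall k, 0 <= f k 0.
Hypothesis PP : forall h : 'cV[R[i]]_nh, P *m (adj P *m h) = h.
Hypothesis Mr : 2 * eta * opnorm (adj A *m A) <= r.
Variables (u : nat -> 'cV[R[i]]_n) (v : nat -> 'cV[R[i]]_nh).
Variables (z Ga : nat -> 'cV[R[i]]_m) (La : nat -> 'cV[R[i]]_nh).
Hypothesis st : forall k, block_step eps r eta A P f (u k) (u k.+1) (v k.+1)
  (z k.+1) (La k) (La k.+1) (Ga k) (Ga k.+1).
Local Notation p := (huber_grad eps f).
Local Notation c := eps^-1.

Lemma block_z_opt k h : rinner (z k.+1 - p (z k.+1)) h = eta * rinner (Ga k.+1) h.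
Proof. exact: (step_z_opt eps01 f0 (st k)). Qed.

Lemma block_u_opt k h :
  eta * rinner (Ga k.+1 + A *m u k.+1 - z k.+1) (A *m h)
    + r * rinner (La k.+1) (P *m h) = 0.
Proof. exact: (step_u_opt (st k)). Qed.

Lemma block_Au k : A *m u k = z k.+1 + (Ga k.+1 - Ga k).
Proof.
rewrite (step_Ga (st k)); move: (A *m u k) => a.
by apply/matrixP => i j; rewrite !mxE; ring.
Qed.

Lemma block_dual_residual k : La k.+1 - La k = P *m u k.+1 - v k.+1.
Proof. by rewrite (step_La (st k)) addrAC [La k + _]addrC addrK. Qed.

(** By optimality [eta Ga] is the gradient of [G] at [z], so the Lipschitz bound transfers.
    Optimality is available from index 1 on, whence the shift. *)
Lemma block_Ga_le k : eta ^+ 2 * rinner (Ga k.+2 - Ga k.+1) (Ga k.+2 - Ga k.+1)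
  <= c ^+ 2 * rinner (z k.+2 - z k.+1) (z k.+2 - z k.+1).
Proof.
apply: (le_trans _ (Geps_grad_lipschitz eps01 f (z k.+1) (z k.+2))).
move: (block_z_opt k) (block_z_opt k.+1).
move: (z k.+2 - p _) (z k.+1 - p _) => a b hb ha.
rewrite !rinner_lin !ha !hb !(rinnerC _ a) !(rinnerC _ b) !ha !hb.
by rewrite le_eqVlt; apply/orP; left; apply/eqP; ring.
Qed.

(** [dual_le] applied to the difference of two [u]-conditions two steps apart, which produces the
    sum of two successive dual increments. [block_Au] rewrites the residual in terms of the
    increments of [Au], [z] and [Ga]. *)
Lemma block_dual_increment_le k :
  r * rinner (La k.+3 - La k.+1) (La k.+3 - La k.+1)
  <= eta / 2 * rinner (A *m u k.+3 - A *m u k.+2 - (z k.+2 - z k.+1)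
                       + (Ga k.+3 - Ga k.+2) + (Ga k.+3 - Ga k.+2))
                      (A *m u k.+3 - A *m u k.+2 - (z k.+2 - z k.+1)
                       + (Ga k.+3 - Ga k.+2) + (Ga k.+3 - Ga k.+2)).
Proof.
apply: (dual_le eta0 PP Mr) => h.
have := block_u_opt k.+2 h; have := block_u_opt k h.
have := block_Au k.+1; have := block_Au k.+2.
move: (A *m u k.+3) (A *m u k.+2) (A *m u k.+1) (A *m h) (P *m h).
move=> a3 a2 a1 b q -> ->; rewrite !rinner_lin; lra.
Qed.

(* At [k = 0] the increments vanish, since [0.-1 = 0]. *)
Definition block_potential k : R :=
  block_lagrangian eps r eta A P f (u k) (v k) (z k) (La k) (Ga k)
  - r / 2 * rinner (La k - La k.-1) (La k - La k.-1)
  + (eta + 2 * c) / 6 * rinner (z k - z k.-1) (z k - z k.-1).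

(** Combines [block_lagrangian_step] with [block_dissipation], whose last vector [q - l' + l] is the
    increment of [v]. The remaining bracket involves [v] and cancels only after summing both blocks,
    by [consensus_average]. *)
Lemma block_potential_decrease k :
  block_potential k.+3
    + decay_coef eps eta * rinner (z k.+3 - z k.+2) (z k.+3 - z k.+2)
  <= block_potential k.+2
     + r / 2 * (rinner (P *m u k.+2 + La k.+2 - v k.+3) (P *m u k.+2 + La k.+2 - v k.+3)
              - rinner (P *m u k.+2 + La k.+2 - v k.+2) (P *m u k.+2 + La k.+2 - v k.+2)
              + rinner (v k.+3 - v k.+2) (v k.+3 - v k.+2)).
Proof.
have h1 := block_lagrangian_step eps01 f0 (v k.+2) (z k.+2) (st k.+2).
have h3 := block_dual_increment_le k.
rewrite (_ : La k.+3 - La k.+1 = (La k.+3 - La k.+2) + (La k.+2 - La k.+1)) in h3;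
  last by rewrite addrA subrK.
have := block_dissipation eps01 r0 eta0 (P *m u k.+3 - P *m u k.+2)
          (block_Ga_le k.+1) h3.
have -> : P *m u k.+3 - P *m u k.+2 - (La k.+3 - La k.+2) + (La k.+2 - La k.+1)
  = v k.+3 - v k.+2.
  rewrite !block_dual_residual; apply/matrixP => i j; rewrite !mxE; ring.
rewrite /block_potential /=; lra.
Qed.

(** The dual increment equals the residual [Pu - v], so the correction removes [r/2 |Pu - v|^2];
    completing squares in both multiplier terms leaves quantities bounded along a convergent
    subsequence. *)
Lemma block_potential_ge k :
  - (r / 2 * (rinner (La k.+1) (La k.+1)
              + rinner (P *m u k.+1 - v k.+1) (P *m u k.+1 - v k.+1))
     + eta / 2 * rinner (Ga k.+1) (Ga k.+1)) <= block_potential k.+1.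
Proof.
rewrite /block_potential /block_lagrangian /= block_dual_residual !sqr_vnorm.
have h1 := Geps_ge0 eps01 f0 (z k.+1).
move: (P *m u k.+1 - v k.+1) (A *m u k.+1 - z k.+1) => q w.
have h2 := mulr_ge0 (ltW r0) (rinner_ge0 (La k.+1 + q)).
have h3 := mulr_ge0 (ltW eta0) (rinner_ge0 (Ga k.+1 + w)).
rewrite !rinner_lin (rinnerC q) in h2; rewrite !rinner_lin (rinnerC w) in h3.
have h4 : 0 <= (eta + 2 * c) / 6 * rinner (z k.+1 - z k) (z k.+1 - z k).
  rewrite mulr_ge0 ?rinner_ge0// divr_ge0// addr_ge0 ?(ltW eta0)// mulr_ge0//.
  by rewrite invr_ge0; case/andP: eps01 => /ltW.
lra.
Qed.

Section Vanishing.
Hypothesis inj : exists2 c1 : R, 0 < c1 & forall h, c1 * vnorm h <= vnorm (A *m h).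
Hypothesis dz : vcvg (fun k => z k.+1 - z k) 0.

Lemma vcvg_dGa : vcvg (fun k => Ga k.+1 - Ga k) 0.
Proof.
apply: vcvg_tail; move: (vcvg_comp (leqnSn) dz).
apply: (vcvg_lipschitz_sqr (K := c / eta)).
  by rewrite divr_ge0 ?invr_ge0 ?(ltW eta0)//; case/andP: eps01 => /ltW.
move=> k; rewrite !subr0 expr_div_n mulrAC ler_pdivlMr ?exprn_gt0// mulrC.
exact: block_Ga_le.
Qed.

Lemma vcvg_z_residual : vcvg (fun k => A *m u k - z k) 0.
Proof.
have := vcvgD vcvg_dGa dz; rewrite addr0.
apply: (vcvg_lipschitz (K := 1)) => k.
by rewrite mul1r block_Au [_ + (_ - _) - _]addrAC addrC.
Qed.

Lemma vcvg_dAu : vcvg (fun k => A *m u k.+1 - A *m u k) 0.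
Proof.
have h := vcvg_z_residual; have h' := vcvg_comp (leqnSn) h.
have := vcvgD (vcvgD h' dz) (vcvgN h); rewrite oppr0 !addr0.
apply: (vcvg_lipschitz (K := 1)) => k; rewrite mul1r.
rewrite (_ : A *m u k.+1 - z k.+1 + (z k.+1 - z k) - (A *m u k - z k)
  = A *m u k.+1 - A *m u k)//.
by apply/matrixP => i j; rewrite !mxE; ring.
Qed.

Lemma vcvg_du : vcvg (fun k => u k.+1 - u k) 0.
Proof.
have [c1 c10 Ac] := inj; move: vcvg_dAu.
apply: (vcvg_lipschitz (K := c1^-1)) => k.
by rewrite !subr0 ler_pdivlMl// -mulmxBr Ac.
Qed.

(** The residual is a dual increment, so [dual_le] on two consecutive [u]-conditions bounds it by
    the vanishing increments of [Ga], [Au] and [z]. *)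
Lemma vcvg_v_residual : vcvg (fun k => P *m u k - v k) 0.
Proof.
apply: vcvg_tail; apply: vcvg_tail.
have h k (a : nat -> 'cV[R[i]]_k) (al : vcvg a 0) := vcvg_comp (leqnSn) al.
have := vcvgD (vcvgD (h _ _ vcvg_dGa) (h _ _ vcvg_dAu)) (vcvgN (h _ _ dz)).
rewrite oppr0 !addr0.
apply: (vcvg_lipschitz_sqr (K := Num.sqrt (eta / 2 / r))) => [|k].
  exact: sqrtr_ge0.
rewrite !subr0 sqr_sqrtr ?divr_ge0 ?(ltW r0) ?(ltW eta0)//.
rewrite mulrAC ler_pdivlMr// mulrC -block_dual_residual.
apply: (dual_le eta0 PP Mr) => g.
have := block_u_opt k.+1 g; have := block_u_opt k g.
move: (A *m g) (P *m g) (A *m u k.+2) (A *m u k.+1) => a q a2 a1.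
rewrite !rinner_lin; lra.
Qed.

Variables (phi : nat -> nat) (us : 'cV[R[i]]_n) (vs Ls : 'cV[R[i]]_nh).
Variables (zs Gs : 'cV[R[i]]_m).
Hypotheses (phi_gt : forall k, (k < phi k)%N).
Hypotheses (cu : vcvg (u \o phi) us) (cv : vcvg (v \o phi) vs).
Hypotheses (cz : vcvg (z \o phi) zs) (cL : vcvg (La \o phi) Ls).
Hypothesis cG : vcvg (Ga \o phi) Gs.

Let phi_ge k : (k <= phi k)%N. Proof. exact: ltnW. Qed.

Lemma limit_v_residual : P *m us = vs.
Proof.
apply/eqP; rewrite -subr_eq0; apply/eqP.
apply: vcvg_unique (vcvgD (vcvg_mulmx P cu) (vcvgN cv)) _.
exact: (vcvg_comp phi_ge vcvg_v_residual).
Qed.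

Lemma limit_z_residual : A *m us = zs.
Proof.
apply/eqP; rewrite -subr_eq0; apply/eqP.
apply: vcvg_unique (vcvgD (vcvg_mulmx A cu) (vcvgN cz)) _.
exact: (vcvg_comp phi_ge vcvg_z_residual).
Qed.

Lemma limit_u_opt h : eta * rinner Gs (A *m h) + r * rinner Ls (P *m h) = 0.
Proof.
have cW := vcvgD (vcvgD cG (vcvg_mulmx A cu)) (vcvgN cz).
rewrite limit_z_residual addrK in cW.
have l1 := vcvg_rinner (h := A *m h) cW; have l2 := vcvg_rinner (h := P *m h) cL.
have : (fun k => eta * rinner (Ga (phi k) + A *m u (phi k) - z (phi k)) (A *m h)
    + r * rinner (La (phi k)) (P *m h))
    @ \oo --> eta * rinner Gs (A *m h) + r * rinner Ls (P *m h).
  exact: cvgD (cvgM (cvg_cst eta) l1) (cvgM (cvg_cst r) l2).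
(* Since [phi k] exceeds [k] it is a successor, so the optimality condition of the preceding step
   holds at index [phi k]. *)
under eq_fun => k.
  have := block_u_opt (phi k).-1 h.
  rewrite prednK ?(leq_trans _ (phi_gt k))// => ->; over.
by move/(cvg_unique _ (cvg_cst _)) => <-//; exact: Rhausdorff.
Qed.

Lemma limit_z_opt h : rinner (zs - p zs) h = eta * rinner Gs h.
Proof.
have cgrad : vcvg (fun k => z (phi k) - p (z (phi k))) (zs - p zs).
  apply: vcvg_lipschitz_sqr cz => [|k]; last exact: (Geps_grad_lipschitz eps01).
  by rewrite invr_ge0; case/andP: eps01 => /ltW.
have l1 := vcvg_rinner (h := h) cgrad; have l2 := vcvg_rinner (h := h) cG.
have : (fun k => rinner (z (phi k) - p (z (phi k))) h - eta * rinner (Ga (phi k)) h)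
    @ \oo --> rinner (zs - p zs) h - eta * rinner Gs h.
  exact: cvgB l1 (cvgM (cvg_cst eta) l2).
under eq_fun => k.
  have := block_z_opt (phi k).-1 h.
  rewrite prednK ?(leq_trans _ (phi_gt k))// => ->; rewrite subrr; over.
move/(cvg_unique _ (cvg_cst _)) => /(_ (@Rhausdorff R))/eqP.
by rewrite eq_sym subr_eq0 => /eqP.
Qed.

End Vanishing.
End BlockSequence.

(** * Stationarity *)

Section Stationarity.
Set Implicit Arguments.
Unset Strict Implicit.
Import numFieldNormedType.Exports.
Local Open Scope classical_set_scope.
Variable R : realType.

Lemma is_derive0_quadratic (phi : R -> R) (C : R) :
  (forall t, `|phi t - phi 0| <= C * t ^+ 2) -> is_derive (0 : R) (1 : R) phi 0.
Proof.
move=> hphi.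
have cC s : (fun t : R => s * (C * `|t|)) @ 0^' --> (0 : R).
  rewrite [X in _ --> X](_ : _ = s * (C * `|0 : R|)); last by rewrite normr0 !mulr0.
  apply: cvg_within_filter; apply: cvgM; first exact: cvg_cst.
  apply: cvgM; first exact: cvg_cst.
  by apply: cvg_norm; exact: cvg_id.
have lim0 : (fun h : R => h^-1 *: ((phi \o shift 0) (h *: 1) - phi 0)) @ 0^'
            --> (0 : R).
  apply: (squeeze_cvgr _ (cC (-1)) (cC 1)); near=> t.
  have t0 : t != 0 by near: t; exact: nbhs_dnbhs_neq.
  rewrite mulN1r mul1r -ler_norml /= addr0 [t *: 1]mulr1 normrM normfV.
  rewrite ler_pdivrMl ?normr_gt0// (le_trans (hphi t))//.
  rewrite (_ : `|t| * (C * `|t|) = C * `|t| ^+ 2); last by ring.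
  by rewrite real_normK ?num_real.
apply: DeriveDef; first exact: (cvgP _ lim0).
by apply: (cvg_lim (@Rhausdorff R)); exact: lim0.
Unshelve. all: by end_near. Qed.

(** Directions [1] and ['i] give unit vectors, so along them the increment is at most [C t^2] and
    the derivative is 0. Stationarity thus follows without differentiating the two branches of
    [geps]. *)
Lemma partials_zero_quadratic k (F : 'cV[R[i]]_k -> R) x (C : R) :
  (forall h, `|F (x + h) - F x| <= C * rinner h h) -> partials_zero F x.
Proof.
move=> hF j d hd; apply: (@is_derive0_quadratic _ C) => t.
rewrite mul0r scale0r addr0 (le_trans (hF _))// -scalerA rinnerZl rinnerZr.
suff -> : rinner (d *: delta_mx j 0) (d *: delta_mx j 0 : 'cV[R[i]]_k) = 1.
  by rewrite mulr1 expr2.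
rewrite rinnerE (bigD1 j)//= big1 ?addr0 => [|l lj]; rewrite !mxE ?eqxx ?(negbTE lj) /=.
  by case: hd => ->; simpc; rewrite /= ?mul1r ?mulr0 ?addr0 ?add0r.
by rewrite mulr0 /= mulr0 addr0.
Qed.

End Stationarity.

Section BlockStationarity.
Set Implicit Arguments.
Unset Strict Implicit.
Variables (R : realType) (eps r eta : R) (n nh m : nat).
Variables (A : 'M[R[i]]_(m, n)) (P : 'M[R[i]]_(nh, n)) (f : 'cV[R]_m).
Hypotheses (eps01 : 0 < eps < 1) (r0 : 0 < r) (eta0 : 0 < eta).
Hypothesis f0 : forall k, 0 <= f k 0.
Variables (u : 'cV[R[i]]_n) (v La : 'cV[R[i]]_nh) (z Ga : 'cV[R[i]]_m).
Hypotheses (Pu : P *m u = v) (Au : A *m u = z).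
Local Notation blk := (block_lagrangian eps r eta A P f).

(** At a feasible point the linear part of the increment is the optimality condition; only
    [eta/2 |Ah|^2 + r/2 |Ph|^2] is left. *)
Lemma block_lagrangian_u_quadratic :
  (forall h, eta * rinner Ga (A *m h) + r * rinner La (P *m h) = 0) ->
  exists C, forall h, `|blk (u + h) v z La Ga - blk u v z La Ga| <= C * rinner h h.
Proof.
move=> opt; have [KA KA0 hA] := mulmx_bounded A; have [KP KP0 hP] := mulmx_bounded P.
exists (eta / 2 * KA ^+ 2 + r / 2 * KP ^+ 2) => h.
have hA2 : rinner (A *m h) (A *m h) <= KA ^+ 2 * rinner h h.
  by rewrite -!sqr_vnorm -exprMn ler_pXn2r ?nnegrE ?mulr_ge0 ?vnorm_ge0.
have hP2 : rinner (P *m h) (P *m h) <= KP ^+ 2 * rinner h h.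
  by rewrite -!sqr_vnorm -exprMn ler_pXn2r ?nnegrE ?mulr_ge0 ?vnorm_ge0.
have := opt h; rewrite /block_lagrangian !mulmxDr Pu Au !subrr ![_ + _ *m h]addrC !addrK.
rewrite !sqr_vnorm !rinner0r.
move: (A *m h) (P *m h) hA2 hP2 => a q hA2 hP2 opth.
rewrite ger0_norm; last first.
  rewrite [X in 0 <= X](_ : _ = eta / 2 * rinner a a + r / 2 * rinner q q).
    by rewrite addr_ge0 ?mulr_ge0 ?rinner_ge0 ?divr_ge0 ?ltW.
  lra.
have := ler_wpM2l (ltW eta0) hA2; have := ler_wpM2l (ltW r0) hP2; lra.
Qed.

(** [Geps_upper] and [Geps_lower] enclose [G] between parabolas with the same slope, which [opt]
    cancels; the constant dominates both curvatures and the penalty. *)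
Lemma block_lagrangian_z_quadratic :
  (forall h, rinner (z - huber_grad eps f z) h = eta * rinner Ga h) ->
  exists C, forall h, `|blk u v (z + h) La Ga - blk u v z La Ga| <= C * rinner h h.
Proof.
move=> opt; exists ((eps^-1 + 1 + eta) / 2) => h.
have := Geps_lower eps01 f0 z (z + h); have := Geps_upper eps01 f0 z (z + h).
rewrite [z + h - z]addrC addKr opt /block_lagrangian Au opprD addNKr !subrr !sqr_vnorm.
rewrite !rinner0r !rinnerNr !rinnerNl => up lo.
have h0 := mulr_ge0 (ltW eta0) (rinner_ge0 h); have h1 := rinner_ge0 h.
have h2 : 0 <= eps^-1 * rinner h h.
  by rewrite mulr_ge0// invr_ge0; case/andP: eps01 => /ltW.
rewrite ler_norml; apply/andP; split; lra.
Qed.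

(** The linear term survives in one block; it cancels in the sum when [L12 + L21 = 0]. *)
Lemma block_lagrangian_v h : blk u (v + h) z La Ga - blk u v z La Ga
  = - r * rinner La h + r / 2 * rinner h h.
Proof.
rewrite /block_lagrangian Pu Au opprD addNKr !subrr !sqr_vnorm.
rewrite !rinner0r !rinnerNr !rinnerNl; ring.
Qed.

Lemma block_lagrangian_La h : blk u v z (La + h) Ga = blk u v z La Ga.
Proof. by rewrite /block_lagrangian Pu subrr !rinner0r. Qed.

Lemma block_lagrangian_Ga h : blk u v z La (Ga + h) = blk u v z La Ga.
Proof. by rewrite /block_lagrangian Au subrr !rinner0r. Qed.

End BlockStationarity.

(** * Coupling of the two blocks through [v] *)

Section Coupling.
Set Implicit Arguments.
Unset Strict Implicit.
Import numFieldNormedType.Exports.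
Local Open Scope classical_set_scope.
Variable R : realType.

Lemma LagE (eps r eta : R) n1 n2 nh m1 m2
  (A1 : 'M[R[i]]_(m1, n1)) (A2 : 'M[R[i]]_(m2, n2))
  (P12 : 'M[R[i]]_(nh, n1)) (P21 : 'M[R[i]]_(nh, n2)) f1 f2
  u1 u2 v z1 z2 L12 L21 G1 G2 :
  Lag eps r eta A1 A2 P12 P21 f1 f2 u1 u2 v z1 z2 L12 L21 G1 G2
  = block_lagrangian eps r eta A1 P12 f1 u1 v z1 L12 G1
    + block_lagrangian eps r eta A2 P21 f2 u2 v z2 L21 G2.
Proof. by rewrite /Lag /block_lagrangian; ring. Qed.

Lemma stationary_of_optimality (eps r eta : R) n1 n2 nh m1 m2
  (A1 : 'M[R[i]]_(m1, n1)) (A2 : 'M[R[i]]_(m2, n2))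
  (P12 : 'M[R[i]]_(nh, n1)) (P21 : 'M[R[i]]_(nh, n2))
  (f1 : 'cV[R]_m1) (f2 : 'cV[R]_m2) (u1 : 'cV[R[i]]_n1) (u2 : 'cV[R[i]]_n2)
  (v L12 L21 : 'cV[R[i]]_nh) (z1 G1 : 'cV[R[i]]_m1) (z2 G2 : 'cV[R[i]]_m2) :
  0 < eps < 1 -> 0 < r -> 0 < eta ->
  (forall k, 0 <= f1 k 0) -> (forall k, 0 <= f2 k 0) ->
  P12 *m u1 = v -> P21 *m u2 = v -> A1 *m u1 = z1 -> A2 *m u2 = z2 ->
  (forall h, eta * rinner G1 (A1 *m h) + r * rinner L12 (P12 *m h) = 0) ->
  (forall h, eta * rinner G2 (A2 *m h) + r * rinner L21 (P21 *m h) = 0) ->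
  (forall h, rinner (z1 - huber_grad eps f1 z1) h = eta * rinner G1 h) ->
  (forall h, rinner (z2 - huber_grad eps f2 z2) h = eta * rinner G2 h) ->
  L12 + L21 = 0 ->
  stationary eps r eta A1 A2 P12 P21 f1 f2
    (State u1 u2 v z1 z2 L12 L21 G1 G2).
Proof.
move=> eps01 r0 eta0 f10 f20 Pu1 Pu2 Au1 Au2 ou1 ou2 oz1 oz2 LL.
have [Cu1 hu1] := block_lagrangian_u_quadratic eps f1 r0 eta0 Pu1 Au1 ou1.
have [Cu2 hu2] := block_lagrangian_u_quadratic eps f2 r0 eta0 Pu2 Au2 ou2.
have [Cz1 hz1] := block_lagrangian_z_quadratic r P12 eps01 eta0 f10 v L12 Au1 oz1.
have [Cz2 hz2] := block_lagrangian_z_quadratic r P21 eps01 eta0 f20 v L21 Au2 oz2.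
split; split.
- apply: (partials_zero_quadratic (C := Cu1)) => h.
  by rewrite !LagE opprD addrACA subrr addr0.
- apply: (partials_zero_quadratic (C := Cu2)) => h.
  by rewrite !LagE opprD addrACA subrr add0r.
- apply: (partials_zero_quadratic (C := r)) => h.
  rewrite !LagE opprD addrACA !block_lagrangian_v//.
  have -> : rinner L21 h = - rinner L12 h.
    by apply/eqP; rewrite -addr_eq0 addrC -rinnerDl LL rinner0l.
  rewrite (_ : _ + _ = r * rinner h h); last by field.
  by rewrite ger0_norm ?mulr_ge0 ?rinner_ge0 ?(ltW r0).
- apply: (partials_zero_quadratic (C := Cz1)) => h.
  by rewrite !LagE opprD addrACA subrr addr0.
- apply: (partials_zero_quadratic (C := Cz2)) => h.
  by rewrite !LagE opprD addrACA subrr add0r.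
- apply: (partials_zero_quadratic (C := 0)) => h.
  by rewrite !LagE block_lagrangian_La// subrr normr0 mul0r.
- apply: (partials_zero_quadratic (C := 0)) => h.
  by rewrite !LagE block_lagrangian_La// subrr normr0 mul0r.
- apply: (partials_zero_quadratic (C := 0)) => h.
  by rewrite !LagE block_lagrangian_Ga// subrr normr0 mul0r.
- apply: (partials_zero_quadratic (C := 0)) => h.
  by rewrite !LagE block_lagrangian_Ga// subrr normr0 mul0r.
Qed.

(** The mean [v'] of [a1] and [a2] minimizes [|a1 - v|^2 + |a2 - v|^2], and moving from [v] to [v']
    lowers this sum by exactly [2 |v' - v|^2]. *)
Lemma consensus_average k (a1 a2 v v' : 'cV[R[i]]_k) : v' + v' = a1 + a2 ->
  rinner (a1 - v') (a1 - v') - rinner (a1 - v) (a1 - v) + rinner (v' - v) (v' - v)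
  + (rinner (a2 - v') (a2 - v') - rinner (a2 - v) (a2 - v) + rinner (v' - v) (v' - v))
  = 0.
Proof.
move=> /(canLR (addKr _)) <-; rewrite !rinner_lin (rinnerC v' v).
rewrite (rinnerC v a1) (rinnerC v' a1); ring.
Qed.

Lemma vcvg_bounded k (a : nat -> 'cV[R[i]]_k) l : vcvg a l ->
  exists C, forall j, rinner (a j) (a j) <= C.
Proof.
move=> al; have cva : cvgn (fun j => vnorm (a j - l)) by exact: (cvgP _ al).
have [N [_ /(_ (N + 1)) aM]] := cvg_seq_bounded cva.
pose M := N + 1; rewrite -/M in aM.
exists ((M + vnorm l) ^+ 2) => j; rewrite -sqr_vnorm.
have ajM : vnorm (a j - l) <= M.
  by have /= := aM (ltr_pwDr ltr01 (lexx N)) j I; rewrite ger0_norm ?vnorm_ge0.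
have aj : vnorm (a j) <= M + vnorm l.
  by rewrite -{1}(subrK l (a j)) (le_trans (vnormD _ _))// lerD2r.
by rewrite ler_pXn2r ?nnegrE ?vnorm_ge0// (le_trans (vnorm_ge0 (a j))).
Qed.

(** Since [S] lies in [T], the rows of [P] are distinct coordinate vectors, so [P P^*] is the
    identity. *)
Lemma restr_mulmx_tr_adj n (S T : {set 'I_n}) : S \subset T ->
  forall h : 'cV[R[i]]_#|S|,
  (restr R S *m (restr R T)^T) *m (adj (restr R S *m (restr R T)^T) *m h) = h.
Proof.
move=> ST h; set P := restr R S *m _.
have PE j a : P j a = (enum_val j == enum_val a)%:R.
  rewrite mxE (bigD1 (enum_val j))//= big1 ?addr0 => [|l lj]; rewrite !mxE ?eqxx ?mul1r.
    by case: ifP.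
  by rewrite (negbTE lj) mul0r.
clearbody P; suff PP : P *m adj P = 1%:M by rewrite mulmxA PP mul1mx.
apply/matrixP => j k; rewrite !mxE.
have jT : enum_val j \in T by apply: (fintype.subsetP ST); exact: enum_valP.
have -> : (j == k) = (enum_val k == enum_val (enum_rank_in jT (enum_val j))).
  by rewrite enum_rankK_in// (inj_eq enum_val_inj) eq_sym.
rewrite (bigD1 (enum_rank_in jT (enum_val j)))//= big1 ?addr0 => [|l lj].
  rewrite !mxE !PE enum_rankK_in// eqxx mul1r.
  by case: (_ == _); rewrite /cconj /= ?oppr0.
rewrite !mxE PE; case: eqP => [jl|_]; last by rewrite mul0r.
by case/eqP: lj; apply: enum_val_inj; rewrite enum_rankK_in.
Qed.

Lemma vnorm_le_sdist n1 n2 nh m1 m2 (X Y : state R n1 n2 nh m1 m2) :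
  and [/\ vnorm (su1 X - su1 Y) <= sdist X Y, vnorm (su2 X - su2 Y) <= sdist X Y,
        vnorm (sv X - sv Y) <= sdist X Y, vnorm (sz1 X - sz1 Y) <= sdist X Y &
        vnorm (sz2 X - sz2 Y) <= sdist X Y]
      [/\ vnorm (sL12 X - sL12 Y) <= sdist X Y, vnorm (sL21 X - sL21 Y) <= sdist X Y,
        vnorm (sG1 X - sG1 Y) <= sdist X Y & vnorm (sG2 X - sG2 Y) <= sdist X Y].
Proof.
have le_sqrt (x y : R) : 0 <= x -> x ^+ 2 <= y -> x <= Num.sqrt y.
  by move=> x0 xy; rewrite -(ger0_norm x0) -sqrtr_sqr ler_wsqrtr.
split; split; apply: le_sqrt; rewrite ?vnorm_ge0//;
  have := (sqr_ge0 (vnorm (su1 X - su1 Y)), sqr_ge0 (vnorm (su2 X - su2 Y)),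
    sqr_ge0 (vnorm (sv X - sv Y)), sqr_ge0 (vnorm (sz1 X - sz1 Y)),
    sqr_ge0 (vnorm (sz2 X - sz2 Y)), sqr_ge0 (vnorm (sL12 X - sL12 Y)),
    sqr_ge0 (vnorm (sL21 X - sL21 Y)), sqr_ge0 (vnorm (sG1 X - sG1 Y)),
    sqr_ge0 (vnorm (sG2 X - sG2 Y)));
  move=> [[[[[[[[? ?] ?] ?] ?] ?] ?] ?] ?]; lra.
Qed.

End Coupling.

(** * Limit points of the full algorithm *)

Section Convergence.
Set Implicit Arguments.
Unset Strict Implicit.
Import numFieldNormedType.Exports.
Local Open Scope classical_set_scope.

Lemma OD2P_limit_stationary (R : realType) (eps r eta : R) n1 n2 nh m1 m2
  (A1 : 'M[R[i]]_(m1, n1)) (A2 : 'M[R[i]]_(m2, n2))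
  (P12 : 'M[R[i]]_(nh, n1)) (P21 : 'M[R[i]]_(nh, n2))
  (f1 : 'cV[R]_m1) (f2 : 'cV[R]_m2) (X : nat -> state R n1 n2 nh m1 m2) Xs :
  0 < eps < 1 ->
  (forall k, 0 <= f1 k 0) -> (forall k, 0 <= f2 k 0) ->
  (forall h : 'cV[R[i]]_nh, P12 *m (adj P12 *m h) = h) ->
  (forall h : 'cV[R[i]]_nh, P21 *m (adj P21 *m h) = h) ->
  paramK eps r eta A1 A2 P12 P21 ->
  (exists2 c1 : R, 0 < c1 & forall h, c1 * vnorm h <= vnorm (A1 *m h)) ->
  (exists2 c2 : R, 0 < c2 & forall h, c2 * vnorm h <= vnorm (A2 *m h)) ->
  OD2P eps r eta A1 A2 P12 P21 f1 f2 X ->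
  seq_limit_point X Xs -> stationary eps r eta A1 A2 P12 P21 f1 f2 Xs.
Proof.
move=> eps01 f10 f20 PP1 PP2 [r0 eta0 _ Kr Keta] inj1 inj2 [_ [_ alg]] [phi0 [phi0S phi0l]].
have decay0 : 0 < decay_coef eps eta.
  apply: decay_coef_gt0 => //; apply: (lt_le_trans Keta); rewrite gerBl.
  rewrite mulr_ge0 ?le_max ?sqr_ge0//.
  by rewrite mulr_ge0 ?invr_ge0 ?sqr_ge0// mulr_ge0 ?sqr_ge0.
have [Mr1 Mr2] : 2 * eta * opnorm (adj A1 *m A1) <= r
              /\ 2 * eta * opnorm (adj A2 *m A2) <= r.
  move: Kr; rewrite subr_gt0 mulrC -ltr_pdivlMr// !gt_max => /andP[/andP[k1 k2] _].
  by split; [move: k1|move: k2]; rewrite ltr_pdivlMr// => /ltW; rewrite mulrAC mulrC mulrCA mulrA.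
pose u1 k := su1 (X k); pose u2 k := su2 (X k); pose v k := sv (X k).
pose z1 k := sz1 (X k); pose z2 k := sz2 (X k).
pose L12 k := sL12 (X k); pose L21 k := sL21 (X k).
pose G1 k := sG1 (X k); pose G2 k := sG2 (X k).
have st1 k : block_step eps r eta A1 P12 f1 (u1 k) (u1 k.+1) (v k.+1)
    (z1 k.+1) (L12 k) (L12 k.+1) (G1 k) (G1 k.+1).
  by have [[hz _ _ hG _] [hu _ [hL _]]] := alg k; split.
have st2 k : block_step eps r eta A2 P21 f2 (u2 k) (u2 k.+1) (v k.+1)
    (z2 k.+1) (L21 k) (L21 k.+1) (G2 k) (G2 k.+1).
  by have [[_ hz _ _ hG] [_ hu [_ hL]]] := alg k; split.
have avg k : v k.+1 + v k.+1
    = (P12 *m u1 k + L12 k) + (P21 *m u2 k + L21 k).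
  rewrite /v; have [[_ _ -> _ _] _] := alg k.
  by rewrite -scalerDl -[2^-1]mul1r -splitr scale1r.
(* The shift makes [phi k] strictly larger than [k], hence positive. *)
pose phi k := phi0 k.+1.
have phi_gt k : (k < phi k)%N.
  rewrite /phi; elim: k.+1 => // j IH; exact: leq_ltn_trans IH (phi0S j).
have philim : (fun k => sdist (X (phi k)) Xs) @ \oo --> (0 : R).
  by rewrite (cvg_shiftS (fun k => sdist (X (phi0 k)) Xs)).
have [[cu1 cu2 cv cz1 cz2] [cL1 cL2 cG1 cG2]] :
  and [/\ vcvg (fun k => u1 (phi k)) (su1 Xs),
          vcvg (fun k => u2 (phi k)) (su2 Xs),
          vcvg (fun k => v (phi k)) (sv Xs),
          vcvg (fun k => z1 (phi k)) (sz1 Xs) &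
          vcvg (fun k => z2 (phi k)) (sz2 Xs)]
      [/\ vcvg (fun k => L12 (phi k)) (sL12 Xs),
          vcvg (fun k => L21 (phi k)) (sL21 Xs),
          vcvg (fun k => G1 (phi k)) (sG1 Xs) &
          vcvg (fun k => G2 (phi k)) (sG2 Xs)].
  by split; split; apply: vcvg_le philim => k;
    have [[? ? ? ? ?] [? ? ? ?]] := vnorm_le_sdist (X (phi k)) Xs.
pose pot1 := block_potential eps r eta A1 P12 f1 u1 v z1 G1 L12.
pose pot2 := block_potential eps r eta A2 P21 f2 u2 v z2 G2 L21.
have [C lowC] : exists C, forall k, - C <= pot1 (phi k) + pot2 (phi k).
  have [C1 b1] := vcvg_bounded cL1; have [C2 b2] := vcvg_bounded cL2.
  have [C3 b3] := vcvg_bounded (vcvgD (vcvg_mulmx P12 cu1) (vcvgN cv)).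
  have [C4 b4] := vcvg_bounded (vcvgD (vcvg_mulmx P21 cu2) (vcvgN cv)).
  have [C5 b5] := vcvg_bounded cG1; have [C6 b6] := vcvg_bounded cG2.
  exists (r / 2 * (C1 + C2 + C3 + C4) + eta / 2 * (C5 + C6)) => k.
  have := block_potential_ge eps01 r0 eta0 f10 st1 (phi k).-1.
  have := block_potential_ge eps01 r0 eta0 f20 st2 (phi k).-1.
  rewrite !prednK ?(leq_trans _ (phi_gt k))// -/pot1 -/pot2 => l2 l1.
  have r2 : 0 <= r / 2 by rewrite divr_ge0 ?(ltW r0).
  have e2 : 0 <= eta / 2 by rewrite divr_ge0 ?(ltW eta0).
  have := ler_wpM2l r2 (lerD (lerD (b1 k) (b2 k)) (lerD (b3 k) (b4 k))).
  have := ler_wpM2l e2 (lerD (b5 k) (b6 k)).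
  lra.
pose q k := decay_coef eps eta *
  (rinner (z1 k.+3 - z1 k.+2) (z1 k.+3 - z1 k.+2)
   + rinner (z2 k.+3 - z2 k.+2) (z2 k.+3 - z2 k.+2)).
have q0 k : 0 <= q k by rewrite /q mulr_ge0 ?(ltW decay0) ?addr_ge0 ?rinner_ge0.
have qlim : q @ \oo --> (0 : R).
  apply: (@decrease_cvg0 _ (fun k => pot1 k.+2 + pot2 k.+2) _ C) => // [k|k].
    have := block_potential_decrease eps01 r0 eta0 f10 PP1 Mr1 st1 k.
    have := block_potential_decrease eps01 r0 eta0 f20 PP2 Mr2 st2 k.
    rewrite -/pot1 -/pot2.
    have := consensus_average (v k.+2) (avg k.+2).
    move=> cons; have := congr1 (fun x => r / 2 * x) cons; rewrite /q /= mulr0; lra.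
  (* The sequence is indexed from 2, so this index evaluates the potentials at [phi k.+2]. *)
  exists (phi k.+2).-2; last first.
    by rewrite -subn2 -addn2 subnK ?lowC// (leq_trans _ (phi_gt k.+2)).
  by rewrite -subn2 leq_subRL ?(leq_trans _ (phi_gt k.+2))// ltnW// phi_gt.
have dz1 : vcvg (fun k => z1 k.+1 - z1 k) 0.
  do 2!apply: vcvg_tail; apply: vcvg0_sqr.
  apply: (squeeze_cvgr _ (cvg_cst 0) (_ : (fun k => (decay_coef eps eta)^-1 * q k) @ \oo --> 0)).
    near=> k; rewrite rinner_ge0 /q mulKf ?gt_eqF//=.
    by rewrite lerDl rinner_ge0.
  by rewrite -(mulr0 (decay_coef eps eta)^-1); exact: cvgM (cvg_cst _) qlim.
have dz2 : vcvg (fun k => z2 k.+1 - z2 k) 0.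
  do 2!apply: vcvg_tail; apply: vcvg0_sqr.
  apply: (squeeze_cvgr _ (cvg_cst 0) (_ : (fun k => (decay_coef eps eta)^-1 * q k) @ \oo --> 0)).
    near=> k; rewrite rinner_ge0 /q mulKf ?gt_eqF//=.
    by rewrite lerDr rinner_ge0.
  by rewrite -(mulr0 (decay_coef eps eta)^-1); exact: cvgM (cvg_cst _) qlim.
have L0 : sL12 Xs + sL21 Xs = 0.
  apply: vcvg_unique (vcvgD cL1 cL2) _.
  have du1 := vcvg_du eps01 eta0 f10 st1 inj1 dz1.
  have du2 := vcvg_du eps01 eta0 f20 st2 inj2 dz2.
  have := vcvgD (vcvg_mulmx P12 du1) (vcvg_mulmx P21 du2).
  rewrite !mulmx0 addr0 => sum0.
  (* Adding the two multiplier updates, the averaging rule for [v] cancels the old multipliers and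
     leaves only images of the increments of [u1] and [u2]. *)
  have cL : vcvg (fun k => L12 k + L21 k) 0.
    apply: vcvg_tail; apply: (vcvg_lipschitz (K := 1)) sum0 => k.
    rewrite mul1r (_ : L12 k.+1 + L21 k.+1
      = P12 *m (u1 k.+1 - u1 k) + P21 *m (u2 k.+1 - u2 k))//.
    rewrite (step_La (st1 k)) (step_La (st2 k)) !mulmxBr addrACA -opprD (avg k).
    move: (P12 *m u1 k) (P12 *m u1 k.+1) (P21 *m u2 k) (P21 *m u2 k.+1) => a b c d.
    by apply/matrixP => i j; rewrite !mxE; ring.
  by apply: vcvg_comp cL => k; exact: ltnW.
case: Xs cu1 cu2 cv cz1 cz2 cL1 cL2 cG1 cG2 L0 {phi0l philim} =>
  u1s u2s vs z1s z2s L12s L21s G1s G2s /=.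
move=> cu1 cu2 cv cz1 cz2 cL1 cL2 cG1 cG2 L0.
apply: stationary_of_optimality => //.
- exact: (limit_v_residual eps01 r0 eta0 f10 PP1 Mr1 st1 dz1 phi_gt cu1 cv).
- exact: (limit_v_residual eps01 r0 eta0 f20 PP2 Mr2 st2 dz2 phi_gt cu2 cv).
- exact: (limit_z_residual eps01 eta0 f10 st1 dz1 phi_gt cu1 cz1).
- exact: (limit_z_residual eps01 eta0 f20 st2 dz2 phi_gt cu2 cz2).
- exact: (limit_u_opt eps01 eta0 f10 st1 dz1 phi_gt cu1 cz1 cL1 cG1).
- exact: (limit_u_opt eps01 eta0 f20 st2 dz2 phi_gt cu2 cz2 cL2 cG2).
- exact: (limit_z_opt eps01 f10 st1 phi_gt cz1 cG1).
- exact: (limit_z_opt eps01 f20 st2 phi_gt cz2 cG2).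
Unshelve. all: by end_near. Qed.

End Convergence.

Theorem theorem2p6 (R : realType) (eps : R) (n : nat)
  (Om1 Om2 : {set 'I_n}) (mb J1 J2 : nat) (w : 'cV[R[i]]_mb)
  (S1 : 'I_J1 -> 'M[R[i]]_(mb, #|Om1|)) (S2 : 'I_J2 -> 'M[R[i]]_(mb, #|Om2|))
  (f1 : 'cV[R]_(J1 * mb)) (f2 : 'cV[R]_(J2 * mb)) (r eta : R)
  (X : nat -> state R #|Om1| #|Om2| #|Om1 :&: Om2| (J1 * mb) (J2 * mb)) :
  0 < eps < 1 ->
  Om1 :|: Om2 = [set: 'I_n]%SET -> Om1 :&: Om2 != finset.set0 ->
  (forall j, selection_mx (S1 j)) -> (forall j, selection_mx (S2 j)) ->
  (forall k, 0 <= f1 k 0) -> (forall k, 0 <= f2 k 0) ->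
  let A1 := Aop w S1 in
  let A2 := Aop w S2 in
  let P12 := restr R (Om1 :&: Om2) *m (restr R Om1)^T in
  let P21 := restr R (Om1 :&: Om2) *m (restr R Om2)^T in
  paramK eps r eta A1 A2 P12 P21 ->
  (exists c1 : R, 0 < c1 /\ forall h, c1 * vnorm h <= vnorm (A1 *m h)) ->
  (exists c2 : R, 0 < c2 /\ forall h, c2 * vnorm h <= vnorm (A2 *m h)) ->
  OD2P eps r eta A1 A2 P12 P21 f1 f2 X ->
  forall Xs, seq_limit_point X Xs ->
    stationary eps r eta A1 A2 P12 P21 f1 f2 Xs.
Proof.
move=> eps01 _ _ _ _ f10 f20 A1 A2 P12 P21 K [c1 [c10 inj1]] [c2 [c20 inj2]] alg Xs lim.
apply: (OD2P_limit_stationary eps01 f10 f20 _ _ K _ _ alg lim).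
- exact: restr_mulmx_tr_adj (subsetIl Om1 Om2).
- exact: restr_mulmx_tr_adj (subsetIr Om1 Om2).
- by exists c1.
- by exists c2.
Qed.
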